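(* Let $F : L^2(\Omega)\to\mathbb{R}$ be lower semi-continuous and bounded from below. Let $v \in \mathcal{F}_P \cap BV(\Omega)$ with reduced representation $v = v^{t,a}$. Then the following assertions hold. 1. If $t$ is optimal for the problem $(\mathrm{L}_a)$ and the Hessian assumption (H) holds, then $v$ is L-stationary. 2. If $F$ is Fréchet differentiable at $v$ and $v$ is optimal for $(\mathrm{TR}(v,\nabla F(v),\Delta))$ for some $\Delta > 0$, then $v$ is L-stationary. 3. If $v$ is $r$-optimal for some $r > 0$, then $t$ is a local minimizer of $(\mathrm{L}_a)$. If, in addition, the Hessian assumption (H) holds, then $v$ is also L-stationary. 4. Let $F$ be convex, and Fréchet differentiable at $v$. If $v$ is optimal for $(\mathrm{TR}(v,\nabla F(v),\Delta))$ for some $\Delta > 0$, then $v$ is $r$-optimal with $r = \Delta$.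
   Context: Setting: $t_0 < t_f$ are real, $\Omega = (t_0,t_f)$, $\alpha > 0$, $\nu_1 < \cdots < \nu_M$ are integers ($M \ge 1$). $\operatorname{TV}$ is the total variation on $L^1(\Omega)$, $BV(\Omega)$ the space of functions in $L^1(\Omega)$ with finite total variation, and $\mathcal{F}_P$ is the set of $v \in L^2(\Omega)$ with $v(x) \in \{\nu_1,\ldots,\nu_M\}$ for a.a. $x\in\Omega$. $\nabla F(v) \in L^2(\Omega)$ denotes the (Riesz) gradient. Step functions: for $a \in \{\nu_1,\ldots,\nu_M\}^N$ and $t = (t_1,\ldots,t_{N-1})$ with $t_0 \le t_1 \le \cdots \le t_{N-1}\le t_N := t_f$ put $v^{t,a} := \chi_{(t_0,t_1)} a_1 + \sum_{i=1}^{N-1}\chi_{[t_i,t_{i+1})} a_{i+1}$. Every $v \in \mathcal{F}_P \cap BV(\Omega)$ equals (a.e.) some $v^{t,a}$ with $t_0 < t_1 < \cdots < t_N = t_f$ and $a_i \ne a_{i+1}$ for $i=1,\ldots,N-1$; this is called the reduced representation of $v$. Switching location problem: $(\mathrm{L}_a)$ is the problem of minimizing $F(v^{t,a})$ over $t \in \mathbb{R}^{N-1}$ subject to $t_{i-1}\le t_i$ for all $i \in \{1,\ldots,N\}$ (with $t_0$ and $t_N = t_f$ fixed). Trust-region problem: $(\mathrm{TR}(\tilde v,\tilde g,\Delta))$ is the problem of minimizing $(\tilde g, w - \tilde v)_{L^2(\Omega)} + \alpha\operatorname{TV}(w) - \alpha\operatorname{TV}(\tilde v)$ over $w \in \mathcal{F}_P$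 with $\|w - \tilde v\|_{L^1(\Omega)} \le \Delta$. $r$-optimality: $v \in \mathcal{F}_P$ is $r$-optimal if $F(v) + \alpha\operatorname{TV}(v) \le F(\tilde v) + \alpha\operatorname{TV}(\tilde v)$ for all $\tilde v \in \mathcal{F}_P$ with $\|v - \tilde v\|_{L^1(\Omega)} \le r$. L-stationarity: let $v = v^{t,a}$ be the reduced representation and $g = \nabla F(v)$. For $i = 1,\ldots,N-1$ set $\overline{D_i^+}(g) = \limsup_{h\downarrow 0}\frac1h\int_{t_i}^{t_i+h} g\,ds$, $\underline{D_i^+}(g) = \liminf_{h\downarrow 0}\frac1h\int_{t_i}^{t_i+h} g\,ds$, $\overline{D_i^-}(g) = \limsup_{h\downarrow 0}\frac1h\int_{t_i-h}^{t_i} g\,ds$, $\underline{D_i^-}(g) = \liminf_{h\downarrow 0}\frac1h\int_{t_i-h}^{t_i} g\,ds$. Then $v$ is L-stationary if for all $i\in\{1,\ldots,N-1\}$: $\overline{D_i^-}(g) \ge 0 \ge \underline{D_i^+}(g)$ if $a_i < a_{i+1}$, and $\underline{D_i^-}(g) \le 0 \le \overline{D_i^+}(g)$ if $a_{i+1} < a_i$. Hessian assumption (H): $F$ is twice continuously Fréchet differentiable and there is $C > 0$ such that $|\nabla^2F(\xi)(u,w)| \le C\|u\|_{L^1(\Omega)}\|w\|_{L^1(\Omega)}$ for all $\xi,u,w \in L^2(\Omega)$. *)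

(* Defs.v *)
From HB Require Import structures.
From mathcomp Require Import all_boot all_order all_algebra.
From mathcomp Require Import generic_quotient ring_quotient.
From mathcomp Require Import all_classical all_reals all_analysis.
From mathcomp Require Import measurable_realfun ess_sup_inf.

Set Implicit Arguments.
Unset Strict Implicit.
Unset Printing Implicit Defensive.

Import Order.TTheory GRing.Theory Num.Theory.
Import numFieldNormedType.Exports.
Local Open Scope classical_set_scope.
Local Open Scope ring_scope.

(* [LspaceType] (hoelder.v) carries no module structure or norm,
   so L^p(mu) is built here as the quotient of the module [LfunType] by the
   a.e. null functions, normed by ['N[mu]_p]. *)

Lemma ae_eq_Lnorm d (T : measurableType d) (R : realType)
    (mu : {measure set T -> \bar R}) (p : \bar R) (f g : {mfun T >-> R}) :
  {ae mu, forall x, f x = g x} ->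
  ('N[mu]_p[EFin \o f] = 'N[mu]_p[EFin \o g])%E.
Proof.
move=> fg; rewrite unlock; case: p => [r||].
- congr (_ `^ _)%E; apply: ae_eq_integral => //.
  + apply/measurable_EFinP/(@measurableT_comp _ _ _ _ _ _ (@powR R ^~ r)) => //.
    exact/measurableT_comp.
  + apply/measurable_EFinP/(@measurableT_comp _ _ _ _ _ _ (@powR R ^~ r)) => //.
    exact/measurableT_comp.
  + by apply: filterS fg => x /= ->.
- by case: ifPn => // _; apply: eq_ess_sup; apply: filterS fg => x /= ->.
- by case: ifPn => // _; apply: eq_ess_inf; apply: filterS fg => x /= ->.
Qed.

Section Lp_space.
Context d (T : measurableType d) (R : realType).
Variables (mu : {measure set T -> \bar R}) (p : \bar R) (p1 : (1 <= p)%E).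
Local Notation fun_ := (LfunType mu p1).

Definition ae_null : {pred fun_} :=
  [pred f : fun_ | `[< {ae mu, forall x, f x = 0} >]].

Lemma ae_nullP (f : fun_) : reflect {ae mu, forall x, f x = 0} (f \in ae_null).
Proof. exact: asboolP. Qed.

Lemma ae_null_zmod_closed : zmod_closed ae_null.
Proof.
split; first by apply/ae_nullP; exact: aeW.
move=> f g /ae_nullP f0 /ae_nullP g0; apply/ae_nullP.
by apply: filterS2 f0 g0 => x /= fx gx; rewrite -[LHS]/(f x - g x) fx gx subrr.
Qed.

HB.instance Definition _ :=
  GRing.isZmodClosed.Build fun_ ae_null ae_null_zmod_closed.

Definition Lp : Type := Quotient.quot ae_null.
HB.instance Definition _ := GRing.Zmodule.on Lp.
HB.instance Definition _ := EqQuotient.on Lp.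

Definition Lp_repr (u : Lp) : fun_ := repr u.

Definition Lp_fun (u : Lp) : T -> R := Lp_repr u.
Coercion Lp_fun : Lp >-> Funclass.

Definition Lp_class (f : fun_) : Lp := (\pi_Lp f)%qT.

Lemma Lp_class_eq (f g : fun_) :
  Lp_class f = Lp_class g <-> {ae mu, forall x, f x = g x}.
Proof.
split=> [/eqP|fg].
  rewrite -Quotient.idealrBE => /ae_nullP.
  by apply: filterS => x /=; rewrite -[_ x]/(f x - g x) => /eqP; rewrite subr_eq0 => /eqP.
apply/eqP; rewrite -Quotient.idealrBE; apply/ae_nullP.
by apply: filterS fg => x fgx; rewrite -[LHS]/(f x - g x) fgx subrr.
Qed.

Lemma Lp_reprK u : Lp_class (Lp_repr u) = u.
Proof. exact: reprK. Qed.

Lemma Lp_classE (f : fun_) : {ae mu, forall x, Lp_class f x = f x}.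
Proof. by apply/Lp_class_eq; rewrite Lp_reprK. Qed.

Lemma Lp_classD (f g : fun_) : Lp_class (f + g) = Lp_class f + Lp_class g.
Proof. exact: Quotient.pi_add. Qed.

Lemma Lp_eqP (u v : Lp) : u = v <-> {ae mu, forall x, u x = v x}.
Proof. by rewrite -Lp_class_eq !Lp_reprK. Qed.

Lemma Lp_class0 : Lp_class 0 = 0.
Proof. by rewrite -[RHS](subrr (Lp_class 0)) -{2}[0](addr0 0) Lp_classD addrK. Qed.

Lemma Lp_funD (u v : Lp) : {ae mu, forall x, (u + v : Lp) x = u x + v x}.
Proof.
have -> : u + v = Lp_class (Lp_repr u + Lp_repr v) by rewrite Lp_classD !Lp_reprK.
exact: Lp_classE.
Qed.

Definition Lp_scale (a : R) (u : Lp) : Lp := Lp_class (a *: Lp_repr u).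

Lemma Lp_classZ a (f : fun_) : Lp_class (a *: f) = Lp_scale a (Lp_class f).
Proof.
apply/Lp_class_eq; apply: filterS (Lp_classE f) => x /= fx.
by rewrite -[LHS]/(a *: f x) -fx.
Qed.

Lemma Lp_scaleA a b u : Lp_scale a (Lp_scale b u) = Lp_scale (a * b) u.
Proof. by rewrite -(Lp_reprK u) -!Lp_classZ scalerA. Qed.

Lemma Lp_scale1 : left_id 1 Lp_scale.
Proof. by move=> u; rewrite -(Lp_reprK u) -!Lp_classZ scale1r. Qed.

Lemma Lp_scaleDr : right_distributive Lp_scale +%R.
Proof.
move=> a u v; rewrite -(Lp_reprK u) -(Lp_reprK v).
by rewrite -Lp_classD -!Lp_classZ -Lp_classD scalerDr.
Qed.

Lemma Lp_scaleDl u : {morph Lp_scale^~ u : a b / a + b}.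
Proof.
by move=> a b; rewrite -(Lp_reprK u) -!Lp_classZ -Lp_classD scalerDl.
Qed.

HB.instance Definition _ := GRing.Zmodule_isLmodule.Build R Lp
  Lp_scaleA Lp_scale1 Lp_scaleDr Lp_scaleDl.

Definition Lp_norm (u : Lp) : R := fine ('N[mu]_p[EFin \o u])%E.

Lemma Lp_norm_class (f : fun_) :
  Lp_norm (Lp_class f) = fine ('N[mu]_p[EFin \o f])%E.
Proof.
by rewrite /Lp_norm (ae_eq_Lnorm _ (Lp_classE f)).
Qed.

Lemma ler_Lp_normD u v : Lp_norm (u + v) <= Lp_norm u + Lp_norm v.
Proof.
rewrite -(Lp_reprK u) -(Lp_reprK v) -Lp_classD !Lp_norm_class.
exact: ler_LnormD.
Qed.

Lemma Lp_normZ a u : Lp_norm (a *: u) = `|a| * Lp_norm u.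
Proof.
rewrite -(Lp_reprK u) -[_ *: _]Lp_classZ !Lp_norm_class.
rewrite [X in fine X](LnormZ (Lp_repr u) a).
by rewrite -(finite_norm_fine (Lp_repr u)) -EFinM.
Qed.

Lemma Lp_norm_eq0 u : Lp_norm u = 0 -> u = 0.
Proof.
rewrite -{2}(Lp_reprK u) -Lp_class0 => /fine_Lnormr_eq0 u0.
by apply/Lp_class_eq; apply: filterS u0 => x; apply.
Qed.

HB.instance Definition _ := Lmodule_isNormed.Build R Lp
  ler_Lp_normD Lp_normZ Lp_norm_eq0.

End Lp_space.

(* Second Frechet derivatives: ['d F] is regarded as a map into the dual of
   [V], and the operator norm of the dual is unfolded.  [B h] stands for the
   derivative of ['d F] at [xi] in direction [h], i.e. for the continuous
   linear form [D^2 F(xi)(h, .)]. *)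

Section second_derivative.
Context (R : realType) (V : normedModType R).
Implicit Types F : V -> R.

Definition is_hessian F (xi : V) (B : {bilinear V -> V -> R}) : Prop :=
  (exists K : R, forall u w : V, `|B u w| <= K * `|u| * `|w|) /\
  forall e : R, 0 < e -> \forall h \near (0 : V), forall w : V,
    `|'d F (xi + h) w - 'd F xi w - B h w| <= e * `|h| * `|w|.

Definition twice_continuously_differentiable F
    (H : V -> {bilinear V -> V -> R}) : Prop :=
  [/\ forall xi, differentiable F xi,
      forall xi, is_hessian F xi (H xi)
    & forall (xi : V) (e : R), 0 < e -> \forall eta \near xi,
        forall u w : V, `|H eta u w - H xi u w| <= e * `|u| * `|w|].

End second_derivative.

Section control_problem.
Context (R : realType) (t0 tf : R).

Definition Omega : set R := `]t0, tf[%classic.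

Lemma measurable_Omega : measurable (Omega : set (measurableTypeR R)).
Proof. exact: measurable_itv. Qed.

Lemma lebesgue_Omega_lty :
  (@lebesgue_measure R (Omega : set (measurableTypeR R)) < +oo)%E.
Proof. by rewrite lebesgue_measure_itv /=; case: ifPn => _; rewrite ?ltry. Qed.

Definition mu_Omega : set (measurableTypeR R) -> \bar R :=
  mfrestr measurable_Omega lebesgue_Omega_lty.
HB.instance Definition _ := FiniteMeasure.on mu_Omega.

Definition L2 : Type := Lp mu_Omega (lee1n 2).
HB.instance Definition _ := NormedModule.on L2.

Definition L2_fun (u : L2) : R -> R := Lp_fun u.
Coercion L2_fun : L2 >-> Funclass.

Lemma indic_Lfun (A : set (measurableTypeR R)) (c : R) : measurable A ->
  (fun x => \1_A x * c) \in Lfun mu_Omega 2.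
Proof.
move=> mA; rewrite inE; apply/andP; split; rewrite inE /=.
  exact: measurable_funM.
rewrite /finite_norm; apply: (@le_lt_trans _ _ 'N[mu_Omega]_2[EFin \o cst c])%E.
  rewrite unlock; apply: gt0_ler_poweR => //.
  - by rewrite in_itv /= leey andbT integral_ge0.
  - by rewrite in_itv /= leey andbT integral_ge0.
  - apply: ge0_le_integral => //.
    + by move=> x _; exact: poweR_ge0.
    + apply/measurable_EFinP/(@measurableT_comp _ _ _ _ _ _ (@powR R ^~ 2)) => //.
      by apply/measurableT_comp => //; exact: measurable_funM.
    + apply/measurable_EFinP/(@measurableT_comp _ _ _ _ _ _ (@powR R ^~ 2)) => //.
      exact: measurableT_comp.
    + move=> x _ /=; rewrite lee_fin ge0_ler_powR ?nnegrE//= indicE.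
      by case: (_ \in _); rewrite ?mul1r ?mul0r ?normr0.
have := Lfun_cst mu_Omega c 2; rewrite inE => /andP[_]; by rewrite inE.
Qed.

Definition inner (u w : L2) : R := \int[mu_Omega]_x (u x * w x).

Definition L1norm (u : L2) : R := fine ('N[mu_Omega]_1[EFin \o u])%E.

(* The Riesz representative of ['d F v]; it exists whenever [F] is
   differentiable at [v], and the value [0] is a dummy otherwise. *)
Definition grad (F : L2 -> R) (v : L2) : L2 :=
  xget 0 [set g : L2 | forall w : L2, 'd F v w = inner g w].

Definition hessian_assumption (F : L2 -> R) : Prop :=
  exists2 H : L2 -> {bilinear L2 -> L2 -> R},
    twice_continuously_differentiable F H
  & exists2 C : R, 0 < C
  & forall xi u w : L2, `|H xi u w| <= C * L1norm u * L1norm w.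

Definition test_function (phi : R -> R) : Prop :=
  [/\ forall x, derivable phi x 1, continuous (derive1 phi),
      compact (closure [set x | phi x != 0])
    & closure [set x | phi x != 0] `<=` Omega].

Definition TV (u : R -> R) : \bar R :=
  ereal_sup [set (\int[mu_Omega]_x (u x * derive1 phi x))%:E | phi in
    [set phi : R -> R | test_function phi /\ forall x, `|phi x| <= 1]].

Definition BV (u : R -> R) : Prop := u \in Lfun mu_Omega 1 /\ (TV u < +oo)%E.

Section integer_values.
Context (M : nat) (nu : 'I_M -> int).

Definition FP (v : L2) : Prop :=
  {ae mu_Omega, forall x, exists j, v x = (nu j)%:~R}.

Definition TR_objective (alpha : R) (v g w : L2) : \bar R :=
  ((inner g (w - v))%:E + alpha%:E * TV w - alpha%:E * TV v)%E.

Definition TR_feasible (v : L2) (Delta : R) (w : L2) : Prop :=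
  FP w /\ L1norm (w - v) <= Delta.

Definition TR_optimal (alpha : R) (v g : L2) (Delta : R) (w : L2) : Prop :=
  TR_feasible v Delta w /\
  forall w', TR_feasible v Delta w' ->
    (TR_objective alpha v g w <= TR_objective alpha v g w')%E.

Definition r_optimal (F : L2 -> R) (alpha r : R) (v : L2) : Prop :=
  FP v /\
  forall w : L2, FP w -> L1norm (v - w) <= r ->
    ((F v)%:E + alpha%:E * TV v <= (F w)%:E + alpha%:E * TV w)%E.

End integer_values.

(* A step function with [N = n + 1] pieces has [n] switching points
   [t_1, ..., t_n], stored as [t 0 0, ..., t 0 (n - 1)], and values
   [a_1, ..., a_N], stored as [a 0, ..., a n]; [node t i] is the point [t_i]
   for [0 <= i <= N], including the fixed end points [t_0] and [t_N = tf]. *)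
Section step_functions.
Context (n : nat).
Implicit Types (t : 'rV[R]_n) (a : 'I_n.+1 -> int).

Definition node t (i : nat) : R :=
  if i is j.+1 then oapp (t ord0) tf (insub j) else t0.

Definition step t a : R -> R := fun x =>
  \1_(`]t0, node t 1[%classic) x * (a ord0)%:~R +
  \sum_(i < n) \1_(`[node t i.+1, node t i.+2[%classic) x
               * (a (lift ord0 i))%:~R.

Lemma step_Lfun t a : step t a \in Lfun mu_Omega 2.
Proof.
have itvL (i : interval R) (c : R) :
    (fun x => \1_([set` i]) x * c) \in Lfun mu_Omega 2.
  by apply: indic_Lfun; exact: measurable_itv.
have [L0 LD] := @Lfun_addr_closed _ _ _ mu_Omega _ (lee1n 2).
have addL (f g : R -> R) : f \in Lfun mu_Omega 2 -> g \in Lfun mu_Omega 2 ->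
    (fun x => f x + g x) \in Lfun mu_Omega 2.
  by move=> fL gL; exact: (LD f g fL gL).
apply/addL => //.
elim: (index_enum _) => [|i s IH].
  by under eq_fun do [rewrite big_nil]; exact: L0.
by under eq_fun do [rewrite big_cons /=]; exact: addL.
Qed.

Definition stepL2 t a : L2 := Lp_class (Lfun_Sub (lee1n 2) (step_Lfun t a)).

Definition ordered t : Prop :=
  forall i : 'I_n.+1, node t i <= node t i.+1.

Definition reduced_representation (M : nat) (nu : 'I_M -> int) (v : L2) t a
    : Prop :=
  [/\ v = stepL2 t a,
      forall i, exists j, a i = nu j,
      forall i : 'I_n.+1, node t i < node t i.+1
    & forall i : 'I_n, a (widen_ord (leqnSn n) i) != a (lift ord0 i)].

Definition L_optimal (F : L2 -> R) a t : Prop :=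
  ordered t /\
  forall s, ordered s -> F (stepL2 t a) <= F (stepL2 s a).

Definition L_local_minimizer (F : L2 -> R) a t : Prop :=
  ordered t /\
  \forall s \near t, ordered s -> F (stepL2 t a) <= F (stepL2 s a).

Definition mean_right (g : R -> R) (c h : R) : \bar R :=
  (h^-1 * \int[lebesgue_measure]_(s in `[c, c + h]) g s)%:E.
Definition mean_left (g : R -> R) (c h : R) : \bar R :=
  (h^-1 * \int[lebesgue_measure]_(s in `[c - h, c]) g s)%:E.

Definition Dplus_sup g c : \bar R := limf_esup (mean_right g c) 0^'+.
Definition Dplus_inf g c : \bar R := limf_einf (mean_right g c) 0^'+.
Definition Dminus_sup g c : \bar R := limf_esup (mean_left g c) 0^'+.
Definition Dminus_inf g c : \bar R := limf_einf (mean_left g c) 0^'+.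

(* [t] and [a] are meant to be the reduced representation of [v]. *)
Definition L_stationary (F : L2 -> R) (v : L2) t a : Prop :=
  let g := grad F v in
  forall i : 'I_n,
    let ai := a (widen_ord (leqnSn n) i) in
    let ai1 := a (lift ord0 i) in
    (ai < ai1 ->
       (0 <= Dminus_sup g (t ord0 i))%E /\ (Dplus_inf g (t ord0 i) <= 0)%E) /\
    (ai1 < ai ->
       (Dminus_inf g (t ord0 i) <= 0)%E /\ (0 <= Dplus_sup g (t ord0 i))%E).

End step_functions.
End control_problem.

(* Main.v *)
(** Idea.  Moving one switching point [t_i] by [h] changes [v^{t,a}] only on an
    interval of length [|h|], by minus or plus the jump [a_{i+1} - a_i], and it
    does not increase the total variation as long as the order of the switching
    points is kept.  Testing optimality with these perturbations bounds
    [+-(a_{i+1} - a_i)] times the one-sided means of the gradient by [O(h)]: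
    exactly by 0 for the trust-region problem, and by the second order term
    [C |u|_{L^1}^2 = O(h^2)] of the Taylor expansion under (H).  Dividing by [h]
    gives L-stationarity.  Part 4 is the gradient inequality of convex functions;
    it needs the Riesz representation of ['d F v] in L^2, which comes from the
    Radon-Nikodym derivative of the charge [A |-> 'd F v (1_A)]. *)

Require Import Defs.
From HB Require Import structures.
From mathcomp Require Import all_boot all_order all_algebra.
From mathcomp Require Import all_classical all_reals all_analysis.
From mathcomp Require Import measurable_realfun ring lra.

Set Implicit Arguments.
Unset Strict Implicit.
Unset Printing Implicit Defensive.

Import Order.TTheory GRing.Theory Num.Theory.
Import numFieldNormedType.Exports HBNNSimple.
Local Open Scope classical_set_scope.
Local Open Scope ring_scope.

(** Competitors may have coinciding switching points, and the total variation is a supremum over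
    test functions. A step function is therefore written as its first value plus jumps times
    Heaviside functions, an identity valid for weakly ordered points. Its pairing with the
    derivative of [phi] becomes minus the sum of jumps times values of [phi] at the switching
    points, so comparing total variations amounts to interpolating finitely many values by a test
    function; this works because the points of the reduced representation are distinct.

    Parts 1 to 3 share one criterion with a quadratic slack [K i * h ^+ 2], where [K] is 0 for the
    trust-region problem and [C] times the squared jump under (H). Under (H) the Riesz
    representation is needed too: the first order Taylor term must be an inner product with
    [grad F v] before means of the gradient appear.

    In the Riesz theorem the Radon-Nikodym density is a priori only in L^1. Its square integrability
    is the main work; it comes from pairing with simple functions below its positive and negative
    parts. *)

Section restricted_measure.
Context d (T : measurableType d) (R : realType) (mu : {measure set T -> \bar R}).

(** The complement of [D] can be added to the exceptional set, because the restricted measure does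
    not charge it. Identities on [Omega] thus become almost everywhere identities for [mu_Omega]. *)
Lemma ae_mrestr (D : set T) (mD : measurable D) (P : set T) :
  {ae mu, forall x, D x -> P x} -> {ae mrestr mu mD, forall x, P x}.
Proof.
move=> [N [mN N0 NP]]; exists (N `|` ~` D); split.
- exact/measurableU/measurableC.
- apply/eqP; rewrite -measure_le0.
  apply: (@le_trans _ _ (mu N)); last by rewrite N0.
  rewrite /= /mrestr setIUl setICl setU0.
  by apply: le_measure => //; rewrite inE//; exact: measurableI.
- move=> x Px; have [Dx|] := pselect (D x); last by right.
  by left; apply: NP => DP; apply: Px; exact: DP.
Qed.

Variables (D : set T) (mD : measurable D).

(** [mu] is the sum of its restrictions to [D] and to the complement of [D], and the extension of
    [f] by 0 outside [D] has integral 0 for the second one. *)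
Lemma ge0_integral_mrestr (f : T -> \bar R) :
  (forall x, (0 <= f x)%E) -> measurable_fun setT f ->
  (\int[mrestr mu mD]_x f x = \int[mu]_(x in D) f x)%E.
Proof.
move=> f0 mf.
have mC : measurable (~` D) by exact: measurableC.
have mfD : measurable_fun setT (f \_ D).
  by apply/(measurable_restrictT f mD); exact: measurable_funS mf.
have fD0 x : (0 <= (f \_ D) x)%E by rewrite patchE; case: ifPn.
have muE A : measurable A -> mu A = measure_add (mrestr mu mD) (mrestr mu mC) A.
  move=> mA; rewrite measure_addE /= /mrestr -measureU//; last first.
  - by rewrite setIACA setICr setI0.
  - exact: measurableI.
  - exact: measurableI.
  by rewrite -setIUr setUv setIT.
rewrite [RHS]integral_mkcond.
rewrite (@eq_measure_integral _ _ _ setT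
  (measure_add (mrestr mu mD) (mrestr mu mC)) mu); last first.
  by move=> A mA _; exact: muE.
rewrite ge0_integral_measure_add//.
rewrite [X in (_ + X)%E](_ : _ = 0%E) ?adde0; last first.
  rewrite -(integral0 (mrestr mu mC) setT); apply: ae_eq_integral => //.
  apply: ae_mrestr; apply: aeW => x /= Dx _; rewrite patchE.
  by case: ifPn => //; rewrite inE.
apply: ae_eq_integral => //.
by apply: ae_mrestr; apply: aeW => x /= Dx _; rewrite patchE mem_set.
Qed.

Lemma integral_mrestr (f : T -> \bar R) : measurable_fun setT f ->
  (\int[mrestr mu mD]_x f x = \int[mu]_(x in D) f x)%E.
Proof.
move=> mf; rewrite [LHS]integralE [RHS]integralE.
by rewrite !ge0_integral_mrestr//;
  [exact: measurable_funeneg|exact: measurable_funepos].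
Qed.

End restricted_measure.

(** * Square integrable functions *)

Section L2_measure.
Context d (T : measurableType d) (R : realType) (mu : {finite_measure set T -> \bar R}).
Local Notation L2 := (Lp mu (lee1n 2)).
Implicit Types (g u w : L2) (f : LfunType mu (lee1n 2)).

(** For [mu_Omega] this is convertible with [inner], so results on a general finite measure transfer
    without a bridging lemma. *)
Definition ip (u w : L2) : R := \int[mu]_x (u x * w x).

Lemma Lp_Lfun u : (u : T -> R) \in Lfun mu 2.
Proof. exact: LfunP. Qed.
Hint Resolve Lp_Lfun : core.

Lemma Lfun2_integrable (h : T -> R) : h \in Lfun mu 2 ->
  mu.-integrable setT (EFin \o h).
Proof. by move=> f2; apply/Lfun1_integrable/Lfun_subset12 => //; exact: fin_num_measure. Qed.

Lemma Lfun2_integrableM (f g : T -> R) : f \in Lfun mu 2 -> g \in Lfun mu 2 ->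
  mu.-integrable setT (fun x => (f x * g x)%:E).
Proof. by move=> ff gg; exact/Lfun1_integrable/Lfun2_mul_Lfun1. Qed.

Lemma eq_ae_Rintegral (f g : T -> R) : measurable_fun setT f -> measurable_fun setT g ->
  {ae mu, forall x, f x = g x} -> \int[mu]_x f x = \int[mu]_x g x.
Proof.
move=> mf mg fg; congr fine; apply: ae_eq_integral => //.
- exact/measurable_EFinP.
- exact/measurable_EFinP.
- by apply: filterS fg => x /= ->.
Qed.

Lemma Lp_measurable u : measurable_fun setT (u : T -> R).
Proof. by have /measurable_int/measurable_EFinP := Lfun2_integrable (Lp_Lfun u). Qed.
Hint Resolve Lp_measurable : core.

Lemma ip_class g f : ip g (Lp_class f) = \int[mu]_x (g x * f x).
Proof.
apply: eq_ae_Rintegral; [exact: measurable_funM..|].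
by apply: filterS (Lp_classE f) => x /= <-.
Qed.

Lemma ipDr g u w : ip g (u + w) = ip g u + ip g w.
Proof.
rewrite /ip -RintegralD//; [|exact: Lfun2_integrableM..].
apply: eq_ae_Rintegral.
- exact: measurable_funM.
- by apply/measurable_funD; exact: measurable_funM.
- by apply: filterS (Lp_funD u w) => x ->; rewrite mulrDr.
Qed.

Lemma Lp_funZ (c : R) u : {ae mu, forall x, (c *: u : L2) x = c * u x}.
Proof. by apply: filterS (Lp_classE (c *: Lp_repr u)) => x. Qed.

Lemma ipZr g (c : R) u : ip g (c *: u) = c * ip g u.
Proof.
rewrite /ip -RintegralZl//; last exact: Lfun2_integrableM.
apply: eq_ae_Rintegral.
- exact: measurable_funM.
- by apply/measurable_funM => //; exact: measurable_funM.
- by apply: filterS (Lp_funZ c u) => x ->; rewrite mulrCA.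
Qed.

Lemma fine_Lnorm1 (h : T -> R) : fine 'N[mu]_1[EFin \o h]%E = \int[mu]_x `|h x|.
Proof. by rewrite Lnorm1. Qed.

Lemma Lnorm1_subC u w :
  fine 'N[mu]_1[EFin \o (u - w : L2)%R]%E = fine 'N[mu]_1[EFin \o (w - u : L2)%R]%E.
Proof.
rewrite -[w - u]opprB -[- (u - w)]scaleN1r !fine_Lnorm1.
apply: eq_ae_Rintegral; [exact: measurableT_comp..|].
by apply: filterS (Lp_funZ (-1) (u - w)) => x ->; rewrite mulN1r normrN.
Qed.

Lemma Lnorm2_fin u : 'N[mu]_2[EFin \o u]%E = `|u|%:E.
Proof. by rewrite -(finite_norm_fine (Lp_repr u)). Qed.

Lemma Lp_norm2 u : `|u| ^+ 2 = \int[mu]_x (u x ^+ 2).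
Proof.
apply: EFin_inj; rewrite -powR_mulrn// -poweR_EFin -Lnorm2_fin poweR_Lnorm//.
rewrite /Rintegral fineK; last first.
  by apply: integrable_fin_num => //; exact: Lfun2_integrable_sqr.
by apply: eq_integral => x _; rewrite /= powR_mulrn// real_normK// num_real.
Qed.

Lemma le_ip g u : `|ip g u| <= `|g| * `|u|.
Proof.
have gu := Lfun2_integrableM (Lp_Lfun g) (Lp_Lfun u).
apply: (@le_trans _ _ (fine 'N[mu]_1[EFin \o (g \* u)%R]%E)).
  by rewrite fine_Lnorm1; exact: le_normr_Rintegral.
rewrite -lee_fin EFinM -!Lnorm2_fin fineK.
  by apply: hoelder => //; rewrite [RHS]splitr !div1r.
rewrite Lnorm1; apply: (@integrable_fin_num _ _ _ mu setT) => //.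
exact: integrable_abse.
Qed.

End L2_measure.
#[export] Hint Resolve Lp_Lfun Lp_measurable : core.

Section L2_class.
Context d (T : measurableType d) (R : realType) (mu : {finite_measure set T -> \bar R}).
Local Notation L2 := (Lp mu (lee1n 2)).
Implicit Types (f g h : T -> R) (u : L2).

Lemma Lfun_measurable f p : f \in Lfun mu p -> measurable_fun setT f.
Proof. by rewrite inE => /andP[+ _]; rewrite inE. Qed.

Lemma Lfun2P f : measurable_fun setT f ->
  mu.-integrable setT (fun x => (f x ^+ 2)%:E) -> f \in Lfun mu 2.
Proof.
move=> mf /integrableP[_ f2]; rewrite inE; apply/andP; split; rewrite inE//=.
rewrite /finite_norm unlock; apply: poweR_lty.
apply: le_lt_trans f2; rewrite le_eqVlt; apply/orP; left; apply/eqP.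
apply: eq_integral => x _.
by rewrite [LHS]poweR_EFin powR_mulrn// -normrX.
Qed.

Lemma Lfun2_dominated f h : measurable_fun setT f -> h \in Lfun mu 2 ->
  (forall x, `|f x| <= `|h x|) -> f \in Lfun mu 2.
Proof.
move=> mf hL fh; apply: Lfun2P => //.
apply: le_integrable (Lfun2_integrable_sqr hL) => //.
  by apply/measurable_EFinP; exact: measurable_funX.
move=> x _ /=; rewrite lee_fin !normrX lerXn2r ?nnegrE//.
Qed.

Lemma Lfun2_bounded f (M : R) : measurable_fun setT f -> (forall x, `|f x| <= M) ->
  f \in Lfun mu 2.
Proof.
move=> mf fM; apply: (Lfun2_dominated mf (Lfun_cst mu M 2)) => x.
exact: le_trans (fM x) (ler_norm _).
Qed.

(** Made total by the default value 0, so that classes of indicators, sums and limits can be written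
    down before membership in L^2 is proved. *)
Definition L2class f : L2 :=
  if pselect (f \in Lfun mu 2) is left fL then Lp_class (Lfun_Sub (lee1n 2) fL) else 0.

Lemma L2classE f : f \in Lfun mu 2 -> {ae mu, forall x, L2class f x = f x}.
Proof.
move=> fL; rewrite /L2class; case: pselect => // fL'.
exact: Lp_classE (Lfun_Sub (lee1n 2) fL').
Qed.

Lemma L2class_eq f u : f \in Lfun mu 2 -> {ae mu, forall x, u x = f x} ->
  L2class f = u.
Proof.
move=> fL uf; apply/Lp_eqP; apply: filterS2 uf (L2classE fL) => x -> //.
Qed.

Lemma L2class_fun u : L2class u = u.
Proof. by apply: L2class_eq => //; exact: aeW. Qed.

Lemma Lfun2D f g : f \in Lfun mu 2 -> g \in Lfun mu 2 ->
  (fun x => f x + g x) \in Lfun mu 2.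
Proof. exact: (@Lfun_addr_closed _ _ _ mu _ (lee1n 2)).2. Qed.

Lemma Lfun2Z (c : R) f : f \in Lfun mu 2 -> (fun x => c * f x) \in Lfun mu 2.
Proof.
move=> fL; rewrite (_ : (fun x => _) = c \o* f); first by apply: Lfun_scale; rewrite ?ler1n.
by apply/funext => x /=; rewrite mulrC.
Qed.

Lemma L2classD f g : f \in Lfun mu 2 -> g \in Lfun mu 2 ->
  L2class (fun x => f x + g x) = L2class f + L2class g.
Proof.
move=> fL gL; apply: L2class_eq; first exact: Lfun2D.
apply: filterS3 (L2classE fL) (L2classE gL) (Lp_funD (L2class f) (L2class g)) => x.
by move=> <- <-.
Qed.

Lemma L2classZ c f : f \in Lfun mu 2 -> L2class (fun x => c * f x) = c *: L2class f.
Proof.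
move=> fL; apply: L2class_eq; first exact: Lfun2Z.
apply: filterS2 (L2classE fL) (Lp_classE (c *: Lp_repr (L2class f))) => x <-.
exact.
Qed.

Lemma ip_L2class u f : f \in Lfun mu 2 -> ip u (L2class f) = \int[mu]_x (u x * f x).
Proof.
move=> fL; rewrite /L2class; case: pselect => // fL'.
by rewrite ip_class.
Qed.

Lemma norm_L2class f : f \in Lfun mu 2 ->
  `|L2class f| ^+ 2 = \int[mu]_x (f x ^+ 2).
Proof.
move=> fL; rewrite Lp_norm2; apply: eq_ae_Rintegral.
- exact: measurable_funX.
- by apply: measurable_funX; exact: Lfun_measurable fL.
- by apply: filterS (L2classE fL) => x ->.
Qed.

Lemma Lnorm1_L2class f : f \in Lfun mu 2 ->
  fine 'N[mu]_1[EFin \o L2class f]%E = \int[mu]_x `|f x|.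
Proof.
move=> fL; rewrite fine_Lnorm1; apply: eq_ae_Rintegral.
- exact: measurableT_comp.
- by apply: measurableT_comp => //; exact: Lfun_measurable fL.
- by apply: filterS (L2classE fL) => x ->.
Qed.

Lemma Lfun2_sum (I : Type) (r : seq I) (f : I -> T -> R) :
  (forall i, f i \in Lfun mu 2) -> (fun x => \sum_(i <- r) f i x) \in Lfun mu 2.
Proof.
move=> fL; elim: r => [|i r IH].
  by under eq_fun do rewrite big_nil; exact: Lfun_cst.
by under eq_fun do rewrite big_cons; exact: Lfun2D.
Qed.

Lemma Lfun2_integrable_norm f : f \in Lfun mu 2 ->
  mu.-integrable setT (EFin \o (fun x => `|f x|)).
Proof.
by move=> /Lfun2_integrable fi; have := integrable_abse fi.
Qed.

Lemma le_Rintegral_sum (I : Type) (r : seq I) (f : I -> T -> R) :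
  (forall i, f i \in Lfun mu 2) ->
  \int[mu]_x `|\sum_(i <- r) f i x| <= \sum_(i <- r) \int[mu]_x `|f i x|.
Proof.
move=> fL; elim: r => [|i r IH].
  rewrite big_nil; under eq_Rintegral do rewrite big_nil normr0.
  by rewrite Rintegral_cst// mul0r.
rewrite big_cons; under eq_Rintegral do rewrite big_cons.
have sL := Lfun2_sum r fL.
apply: le_trans (lerD (lexx _) IH).
rewrite -RintegralD//; [|exact: Lfun2_integrable_norm..].
apply: le_Rintegral => //.
- exact: (Lfun2_integrable_norm (Lfun2D (fL i) sL)).
- exact: (integrableD measurableT (Lfun2_integrable_norm (fL i)) (Lfun2_integrable_norm sL)).
- by move=> x _; exact: ler_normD.
Qed.

(** Dominated convergence applied to the squared differences: they tend to 0 pointwise and are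
    bounded by the integrable function [(2 * h x) ^+ 2]. The limit inherits the bound [h], hence
    lies in L^2. *)
Lemma cvg_L2class (f_ : (T -> R)^nat) f h :
  (forall n, measurable_fun setT (f_ n)) -> h \in Lfun mu 2 ->
  (forall n x, `|f_ n x| <= h x) -> (forall x, f_ ^~ x @ \oo --> f x) ->
  L2class (f_ n) @[n --> \oo] --> L2class f.
Proof.
move=> mf_ hL fh cf.
have mf : measurable_fun setT f.
  by apply: (@measurable_fun_cvg _ _ _ setT f_) => // x _; exact: cf.
have fLh x : `|f x| <= h x.
  have : `|f_ n x| @[n --> \oo] --> `|f x| by apply: cvg_norm; exact: cf.
  move=> /[dup] cfx /cvg_lim <- //; apply: limr_le; first by apply/cvg_ex; exists `|f x|.
  by apply: nearW => n.
have fL : f \in Lfun mu 2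
  by apply: Lfun2_dominated hL _ => // x; exact: le_trans (fLh x) (ler_norm _).
have f_L n : f_ n \in Lfun mu 2
  by apply: Lfun2_dominated hL _ => // x; exact: le_trans (fh n x) (ler_norm _).
have dL n : (fun x => f_ n x + (-1) * f x) \in Lfun mu 2.
  by apply: Lfun2D => //; exact: Lfun2Z.
have normE n : `|L2class (f_ n) - L2class f| ^+ 2 =
    \int[mu]_x ((f_ n x + (-1) * f x) ^+ 2).
  by rewrite -norm_L2class// L2classD ?L2classZ ?scaleN1r//; exact: Lfun2Z.
have : (\int[mu]_x ((f_ n x + (-1) * f x) ^+ 2)%:E)%E @[n --> \oo] --> 0%E.
  have [] := @dominated_convergence _ _ _ mu setT measurableT
    (fun n x => ((f_ n x + (-1) * f x) ^+ 2)%:E) (cst 0%E)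
    (fun x => ((2 * h x) ^+ 2)%:E).
  - move=> n; apply/measurable_EFinP; apply: measurable_funX.
    by apply: measurable_funD => //; exact: measurable_funM.
  - exact: measurable_cst.
  - apply: aeW => x _; apply: cvg_EFin; first exact: nearW.
    rewrite -[X in _ --> X](_ : (f x + (-1) * f x) ^+ 2 = 0); last first.
      by rewrite mulN1r subrr expr0n.
    under eq_fun do rewrite expr2.
    rewrite expr2; apply: cvgM; (apply: cvgD; [exact: cf|exact: cvg_cst]).
  - by apply: Lfun2_integrable_sqr; exact: Lfun2Z.
  - apply: aeW => x n _; rewrite lee_fin ger0_norm ?sqr_ge0//.
    rewrite -real_normK ?num_real// lerXn2r ?nnegrE//.
      by rewrite mulr_ge0// (le_trans _ (fLh x)).
    rewrite (le_trans (ler_normD _ _))// mulN1r normrN mulr_natl mulr2n lerD//.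
  by rewrite integral0.
move=> /fine_cvg cint.
apply/cvgrPdist_le => /= e e0.
near=> n.
rewrite distrC -(@ler_pXn2r _ 2)//; [|by rewrite nnegrE|by rewrite nnegrE ltW].
rewrite normE.
near: n.
have /cvgrPdist_le/(_ (e ^+ 2)) :
  (\int[mu]_x ((f_ n x + -1 * f x) ^+ 2)) @[n --> \oo] --> (0 : R) := cint.
rewrite exprn_gt0// => /(_ isT).
apply: filterS => n; rewrite /= sub0r normrN.
by rewrite ger0_norm//; apply: Rintegral_ge0 => x _; exact: sqr_ge0.
Unshelve. all: by end_near. Qed.

End L2_class.

(** * Square integrability by pairing with simple functions *)

Section Riesz.
Context d (T : measurableType d) (R : realType) (mu : {finite_measure set T -> \bar R}).
Local Notation L2 := (Lp mu (lee1n 2)).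
Implicit Types (f g h : T -> R) (u : L2).

Lemma L2class0 : L2class mu (fun=> 0) = 0.
Proof.
apply: L2class_eq; first exact: Lfun_cst.
have := Lp_classE (0 : LfunType mu (lee1n 2)).
by rewrite Lp_class0; apply: filterS => x ->.
Qed.

Lemma Lfun2_indic (A : set T) : measurable A -> (\1_A : T -> R) \in Lfun mu 2.
Proof.
move=> mA; apply: (@Lfun2_bounded _ _ _ _ _ 1) => // x.
by rewrite indicE; case: (_ \in _); rewrite ?normr1 ?normr0.
Qed.

Lemma Lfun2_nnsfun (h : {nnsfun T >-> R}) : (h : T -> R) \in Lfun mu 2.
Proof.
have [M [_ hM]] := simple_bounded h.
apply: (@Lfun2_bounded _ _ _ _ _ (M + 1)) => // x.
by apply: hM; rewrite ?ltrDl.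
Qed.

(* A nonnegative [f] whose pairing with simple functions is bounded in the
   [L2] norm is square integrable: the approximations [h] of the positive part
   satisfy [|h|^2 <= \int f h <= K |h|]. *)
Lemma Lfun2_funrpos f (K : R) : mu.-integrable setT (EFin \o f) ->
  (forall h : {nnsfun T >-> R}, \int[mu]_x (f x * h x) <= K * `|L2class mu h|) ->
  f^\+ \in Lfun mu 2.
Proof.
move=> fi fK; have mf : measurable_fun setT f.
  by apply/measurable_EFinP; exact: measurable_int fi.
have mfp : measurable_fun setT f^\+ by exact: measurable_funrpos.
have mfpE : measurable_fun setT (EFin \o f^\+) by exact/measurable_EFinP.
pose h := nnsfun_approx measurableT mfpE.
have ch x : h ^~ x @ \oo --> f^\+ x.
  apply: (@fine_cvg _ _ _ _ (EFin \o h ^~ x)).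
  by apply: cvg_nnsfun_approx => // y _; rewrite lee_fin.
have ndh m n x : (m <= n)%N -> h m x <= h n x.
  by move=> mn; have /lefP := nd_nnsfun_approx measurableT mfpE mn; apply.
have hle n x : h n x <= f^\+ x.
  rewrite -(cvg_lim _ (ch x))//; apply: (nondecreasing_cvgn_le (u_ := h ^~ x)).
    by move=> m k mk; exact: ndh.
  by apply/cvg_ex; exists (f^\+ x); exact: ch.
(* Where [h n x] is positive, [f^\+ x] is positive too and equals [f x]; elsewhere both sides
   vanish. *)
have hf n x : h n x ^+ 2 <= f x * h n x.
  rewrite expr2; have [hx|] := ltP 0 (h n x); last first.
    by move=> hx0; rewrite (_ : h n x = 0) ?mulr0//; apply/eqP; rewrite eq_le hx0/=.
  rewrite ler_pM2r//; have := hle n x; rewrite /funrpos.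
  by rewrite le_max => /orP[//|]; rewrite leNgt hx.
have h2 n : (\int[mu]_x (h n x ^+ 2)%:E <= (K ^+ 2)%:E)%E.
  have L := Lfun2_nnsfun (h n).
  have i2 := Lfun2_integrable_sqr L.
  rewrite -(@fineK _ (\int[mu]_x _)); last exact: integrable_fin_num.
  rewrite lee_fin.
  rewrite -[leLHS](norm_L2class L).
  have [M [_ hM]] := simple_bounded (h n).
  have fh : mu.-integrable setT (EFin \o (fun x => f x * h n x)).
    have hM1 x : `|h n x| <= M + 1 by apply: hM; rewrite ?ltrDl.
    have fM : mu.-integrable setT (EFin \o (fun x => (M + 1) * f x)).
      exact: (integrableZl measurableT (M + 1) fi).
    apply: le_integrable fM => //.
      by apply/measurable_EFinP; exact: measurable_funM.
    move=> x _ /=; rewrite lee_fin !normrM mulrC ler_wpM2r//.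
    exact: le_trans (hM1 x) (ler_norm _).
  (* Dividing by the norm bounds it by [K] independently of [n]; monotone convergence then passes
     the bound to [f^\+]. *)
  have : `|L2class mu (h n)| ^+ 2 <= K * `|L2class mu (h n)|.
    apply: le_trans (fK (h n)); rewrite norm_L2class//.
    by apply: le_Rintegral => // x _; exact: hf.
  move: (normr_ge0 (L2class mu (h n))); set c := `| _ |.
  rewrite le_eqVlt => /orP[/eqP <-|c0]; first by rewrite expr0n sqr_ge0.
  rewrite {1}expr2 ler_pM2r// => cK.
  by rewrite lerXn2r// nnegrE ltW// (lt_le_trans c0).
apply: Lfun2P => //; apply/integrableP; split.
  by apply/measurable_EFinP; exact: measurable_funX.
under eq_integral do rewrite gee0_abs ?lee_fin ?sqr_ge0//.
apply: (@le_lt_trans _ _ (K ^+ 2)%:E); last exact: ltry.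
have cvh x : (h n x ^+ 2)%:E @[n --> \oo] --> (f^\+ x ^+ 2)%:E.
  apply: cvg_EFin; first exact: nearW.
  by under eq_fun do rewrite expr2; rewrite expr2; apply: cvgM; exact: ch.
rewrite (eq_integral (fun x => limn (fun n => (h n x ^+ 2)%:E))); last first.
  by move=> x _; apply/esym/cvg_lim => //; exact: cvh.
rewrite monotone_convergence//.
- apply: lime_le.
    apply: ereal_nondecreasing_is_cvgn => m n mn.
    apply: ge0_le_integral => //.
    + by move=> x _; rewrite lee_fin sqr_ge0.
    + by apply/measurable_EFinP; exact: measurable_funX.
    + by apply/measurable_EFinP; exact: measurable_funX.
    + move=> x _; rewrite lee_fin lerXn2r ?nnegrE//.
      exact: ndh.
  exact: nearW.
- by move=> n; apply/measurable_EFinP; exact: measurable_funX.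
- by move=> n x _; rewrite lee_fin sqr_ge0.
- move=> x _ m n mn; rewrite lee_fin lerXn2r ?nnegrE//.
  exact: ndh.
Qed.

End Riesz.

(** * Riesz representation *)

Lemma cvg_functional (R : realType) (V : normedModType R) (phi : V -> R) (K : R)
    (u_ : V^nat) (u : V) : {morph phi : u w / u - w} ->
  (forall u, `|phi u| <= K * `|u|) ->
  u_ n @[n --> \oo] --> u -> phi (u_ n) @[n --> \oo] --> phi u.
Proof.
move=> phiB phiK cu; apply/cvgrPdist_le => /= e e0.
have K0 : 0 < `|K| + 1 by rewrite ltr_wpDl.
move/cvgrPdist_le/(_ (e / (`|K| + 1))): cu; rewrite divr_gt0// => /(_ isT).
apply: filterS => n; rewrite ler_pdivlMr// => un.
rewrite -phiB (le_trans (phiK _))// (le_trans _ un)// mulrC ler_wpM2l//.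
by rewrite (le_trans (ler_norm _))// lerDl.
Qed.

Section Riesz_representation.
Context d (T : measurableType d) (R : realType) (mu : {finite_measure set T -> \bar R}).
Local Notation L2 := (Lp mu (lee1n 2)).
Variables (phi : L2 -> R) (K : R).
Hypothesis phiD : {morph phi : u w / u + w}.
Hypothesis phiZ : forall (c : R) u, phi (c *: u) = c * phi u.
Hypothesis phiK : forall u, `|phi u| <= K * `|u|.

Let phi0 : phi 0 = 0.
Proof. by rewrite -(scale0r 0) phiZ mul0r. Qed.

Let phiB : {morph phi : u w / u - w}.
Proof. by move=> u w; rewrite phiD -scaleN1r phiZ mulN1r. Qed.

Definition riesz_charge (A : set T) : \bar R := (phi (L2class mu \1_A))%:E.

Let nu0 : riesz_charge set0 = 0%E.
Proof. by rewrite /riesz_charge indic0 L2class0 phi0. Qed.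

Let nu_fin A : measurable A -> riesz_charge A \is a fin_num.
Proof. by []. Qed.

Let phi_sum (I : Type) (s : seq I) (f : I -> T -> R) :
  (forall i, f i \in Lfun mu 2) ->
  phi (L2class mu (fun x => \sum_(i <- s) f i x)) = \sum_(i <- s) phi (L2class mu (f i)).
Proof.
move=> fL; elim: s => [|i s IH].
  by rewrite big_nil; under eq_fun do rewrite big_nil; rewrite L2class0.
rewrite big_cons -IH; under eq_fun do rewrite big_cons.
by rewrite L2classD ?phiD//; exact: Lfun2_sum.
Qed.

(** For disjoint sets the partial sums of the indicators increase to the indicator of the union and
    stay below 1, which is in L^2 since [mu] is finite. They converge in L^2, and [phi] is
    continuous there. *)
Let nu_sigma_additive : semi_sigma_additive riesz_charge.
Proof.
move=> F mF tF mUF.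
have FL n : (\1_(F n) : T -> R) \in Lfun mu 2 by exact: Lfun2_indic.
under eq_fun do rewrite sumEFin -phi_sum//.
apply: cvg_EFin; first exact: nearW.
apply: (cvg_functional phiB phiK); apply: (@cvg_L2class _ _ _ _ _ _ (cst 1)).
- by move=> n; exact: Lfun_measurable (Lfun2_sum _ FL).
- exact: Lfun_cst.
- move=> n x.
  have le1 : ((\sum_(0 <= i < n) \1_(F i) x)%:E <= (1 : R)%:E)%E.
    rewrite -sumEFin; apply: (@le_trans _ _ (\sum_(0 <= i <oo) (\1_(F i) x)%:E)%E).
      by apply: nneseries_lim_ge => // i _ _; rewrite lee_fin.
    by rewrite -indic_bigcup// lee_fin indicE; case: (_ \in _).
  by rewrite ger0_norm// sumr_ge0.
- move=> x; apply: (@fine_cvg _ _ _ _ (fun n => (\sum_(0 <= i < n) \1_(F i) x)%:E)).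
  rewrite indic_bigcup//; under eq_fun do rewrite -sumEFin.
  by apply: is_cvg_nneseries => n _ _; rewrite lee_fin.
Qed.

HB.instance Definition _ := isCharge.Build _ _ _ riesz_charge
  nu0 nu_fin nu_sigma_additive.

Let nu_dom : riesz_charge `<< mu.
Proof.
apply/null_content_dominatesP => A mA A0; rewrite /riesz_charge.
rewrite (@L2class_eq _ _ _ _ _ 0) ?phi0//; first exact: Lfun2_indic.
have A0' : {ae mu, forall x, \1_A x = 0 :> R}.
  exists A; split => // x /= /eqP; rewrite indicE pnatr_eq0 eqb0 negbK.
  by rewrite inE.
have := L2classE (Lfun_cst mu 0 2).
by rewrite L2class0; apply: filterS2 A0' => x ->.
Qed.

Let g : T -> R := fine \o Radon_Nikodym riesz_charge mu.

Let gE : EFin \o g = Radon_Nikodym riesz_charge mu.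
Proof. by apply/funext => x; rewrite /g /= fineK//; exact: Radon_Nikodym_fin_num. Qed.

Let gi : mu.-integrable setT (EFin \o g).
Proof. by rewrite gE; exact: Radon_Nikodym_integrable. Qed.

Let mg : measurable_fun setT g.
Proof. by apply/measurable_EFinP; exact: measurable_int gi. Qed.

(** As long as [g] is known to be only in L^1, it can be paired with bounded functions alone; simple
    functions are bounded. *)
Let integrable_gM (f : T -> R) (M : R) : measurable_fun setT f ->
  (forall x, `|f x| <= M) -> mu.-integrable setT (EFin \o (fun x => g x * f x)).
Proof.
move=> mf fM; have gM : mu.-integrable setT (EFin \o (fun x => M * g x)).
  exact: (integrableZl measurableT M gi).
apply: le_integrable gM => //.
  by apply/measurable_EFinP; exact: measurable_funM.
move=> x _ /=; rewrite lee_fin !normrM mulrC ler_wpM2r//.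
exact: le_trans (fM x) (ler_norm _).
Qed.

Let indic_le1 (A : set T) x : `|\1_A x : R| <= 1.
Proof. by rewrite indicE; case: (_ \in _); rewrite ?normr1 ?normr0. Qed.

Let phi_indic A : measurable A -> phi (L2class mu \1_A) = \int[mu]_x (g x * \1_A x).
Proof.
move=> mA; rewrite -[LHS]/(fine (riesz_charge A)).
rewrite (@Radon_Nikodym_integral _ _ _ riesz_charge mu A nu_dom mA).
rewrite -gE integral_mkcond; congr fine; apply: eq_integral => x _.
by rewrite patchE indicE; case: ifPn => _; rewrite /= ?mulr1 ?mulr0.
Qed.

Let phi_nnsfun (h : {nnsfun T >-> R}) : phi (L2class mu h) = \int[mu]_x (g x * h x).
Proof.
pose A y : set T := h @^-1` [set y].
have mA y : measurable (A y) by exact: measurable_sfunP.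
have AL y : (fun x => y * \1_(A y) x) \in Lfun mu 2.
  by apply: Lfun2Z; exact: Lfun2_indic.
have -> : (h : T -> R) = fun x => \sum_(y <- finmap.enum_fset (fset_set (range h))) y * \1_(A y) x.
  by apply/funext => x; rewrite fimfunE fsbig_finite//; exact: fimfunP.
rewrite phi_sum//.
have giA y : mu.-integrable setT (EFin \o (fun x => g x * (y * \1_(A y) x))).
  apply: (@integrable_gM _ `|y|); first exact: measurable_funM.
  by move=> x; rewrite normrM ler_piMr.
under [RHS]eq_Rintegral do rewrite mulr_sumr.
elim: (finmap.enum_fset _) => [|y s IH].
  rewrite big_nil; under eq_Rintegral do rewrite big_nil.
  by rewrite Rintegral_cst// mul0r.
rewrite big_cons IH; under [RHS]eq_Rintegral do rewrite big_cons.
rewrite RintegralD//.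
- congr (_ + _); rewrite L2classZ ?phiZ; last exact: Lfun2_indic.
  rewrite phi_indic// -RintegralZl//; last exact: (@integrable_gM _ 1).
  by apply: eq_Rintegral => x _; rewrite mulrCA.
- rewrite (_ : EFin \o _ = fun x => (\sum_(j <- s) (g x * (j * \1_(A j) x))%:E)%E); last first.
    by apply/funext => x /=; rewrite sumEFin.
  by apply: (integrable_sum measurableT) => y0 _; exact: giA.
Qed.

Let gL : g \in Lfun mu 2.
Proof.
have gpL : g^\+ \in Lfun mu 2.
  apply: (Lfun2_funrpos gi) => h.
  by rewrite -phi_nnsfun (le_trans (ler_norm _)).
(* The negative part of [g] is the positive part of its opposite, which represents the opposite of
   [phi] and obeys the same bound [K]. *)
have gnL : g^\- \in Lfun mu 2.
  rewrite -funrposN; apply: (@Lfun2_funrpos _ _ _ _ _ K).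
    by rewrite (_ : _ \o _ = \- (EFin \o g))%E//; exact: integrableN.
  move=> h; under eq_Rintegral do rewrite mulNr -mulN1r.
  rewrite RintegralZl//; last first.
    have [M [_ hM]] := simple_bounded h.
    by apply: (@integrable_gM _ (M + 1)) => // x; apply: hM; rewrite ?ltrDl.
  by rewrite mulN1r -phi_nnsfun (le_trans (ler_norm _))// normrN.
rewrite (_ : g = fun x => g^\+ x + (-1) * g^\- x).
  by apply: Lfun2D => //; exact: Lfun2Z.
by apply/funext => x; rewrite mulN1r -[in LHS](funrposBneg g).
Qed.

(** The continuous functional [psi], the difference of the two sides, vanishes on simple functions.
    A nonnegative [f] in L^2 is an L^2 limit of simple functions dominated by [f] itself, so [psi]
    vanishes there, and then on any [u] by splitting into positive and negative parts. *)
Theorem Riesz_representation : exists w : L2, forall u, phi u = ip w u.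
Proof.
exists (L2class mu g) => u; set w := L2class mu g.
pose psi v := phi v - ip w v.
have psiD : {morph psi : u v / u + v}.
  by move=> x y; rewrite /psi phiD ipDr opprD addrACA.
have psiZ c v : psi (c *: v) = c * psi v by rewrite /psi phiZ ipZr mulrBr.
have psiB : {morph psi : u v / u - v}.
  by move=> x y; rewrite psiD -scaleN1r psiZ mulN1r.
have psiK v : `|psi v| <= (K + `|w|) * `|v|.
  by rewrite mulrDl (le_trans (ler_normB _ _))// lerD// le_ip.
have psi_nnsfun (h : {nnsfun T >-> R}) : psi (L2class mu h) = 0.
  have hL := Lfun2_nnsfun mu h.
  apply/eqP; rewrite subr_eq0 phi_nnsfun ip_L2class//; apply/eqP.
  apply: eq_ae_Rintegral; [exact: measurable_funM..|].
  by apply: filterS (L2classE gL) => x ->.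
have psi_ge0 (f : T -> R) : f \in Lfun mu 2 -> (forall x, 0 <= f x) ->
    psi (L2class mu f) = 0.
  move=> fL f0; have mf : measurable_fun setT (EFin \o f).
    by apply/measurable_EFinP; exact: Lfun_measurable fL.
  pose h := nnsfun_approx measurableT mf.
  have ch x : h ^~ x @ \oo --> f x.
    apply: (@fine_cvg _ _ _ _ (EFin \o h ^~ x)).
    by apply: cvg_nnsfun_approx => // y _; rewrite lee_fin.
  have hle n x : `|h n x| <= f x.
    rewrite ger0_norm// -(cvg_lim _ (ch x))//.
    apply: (nondecreasing_cvgn_le (u_ := h ^~ x)).
      by move=> m k mk; have /lefP := nd_nnsfun_approx measurableT mf mk; apply.
    by apply/cvg_ex; exists (f x); exact: ch.
  have mh n : measurable_fun setT (h n : T -> R) by [].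
  have := cvg_functional psiB psiK (cvg_L2class mh fL hle ch).
  under eq_fun do rewrite psi_nnsfun.
  by move=> /cvg_lim <- //; rewrite lim_cst.
have mu_ : measurable_fun setT (u : T -> R) by [].
have upL : (u : T -> R)^\+ \in Lfun mu 2.
  apply: (Lfun2_dominated _ (Lp_Lfun u)); first exact: measurable_funrpos.
  by move=> x; rewrite ger0_norm ?le_max ?lexx ?orbT// ge_max ler_norm normr_ge0.
have unL : (u : T -> R)^\- \in Lfun mu 2.
  apply: (Lfun2_dominated _ (Lp_Lfun u)); first exact: measurable_funrneg.
  by move=> x; rewrite ger0_norm ?le_max ?lexx ?orbT// ge_max -normrN ler_norm normr_ge0.
have uE : (u : T -> R) = fun x => (u : T -> R)^\+ x + (-1) * (u : T -> R)^\- x.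
  by apply/funext => x; rewrite mulN1r -[in LHS](funrposBneg u).
apply/eqP; rewrite -subr_eq0 -[_ - _]/(psi u).
rewrite -(L2class_fun u) uE L2classD//; last exact: Lfun2Z.
rewrite L2classZ// psiD psiZ !psi_ge0 ?mulr0 ?addr0//.
Qed.

End Riesz_representation.

(** * Step functions *)

Section step_functions.
Context (R : realType) (t0 tf : R) (n : nat).
Local Notation mu := (mu_Omega t0 tf).
Local Notation L2 := (L2 t0 tf).
Local Notation node := (node t0 tf).
Local Notation ordered := (ordered t0 tf).
Implicit Types (t s : 'rV[R]_n) (a : 'I_n.+1 -> int) (x c : R).

Lemma node_last t : node t n.+1 = tf.
Proof. by rewrite /= insubF ?ltnn. Qed.

Lemma nodeS t (i : 'I_n) : node t i.+1 = t ord0 i.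
Proof. by rewrite /= valK. Qed.

Lemma le_node t : ordered t -> {homo node t : i j / (i <= j)%N >-> i <= j}.
Proof.
move=> ot; apply: (@homo_leq _ _ (fun x y => x <= y)) => [//|? ? ?|i].
  exact: le_trans.
have [ni|ni] := ltnP i n.+1; first exact: (ot (Ordinal ni)).
by case: i ni => // i ni; rewrite /= !insubF//; apply/negbTE; rewrite -leqNgt// leqW.
Qed.

Lemma t_in_itv t i : ordered t -> t0 <= t ord0 i <= tf.
Proof.
move=> ot; rewrite -nodeS (le_node ot (leq0n i.+1))/=.
by rewrite -[leRHS](node_last t); exact: (le_node ot (leqW (ltn_ord i))).
Qed.

(** The value 1 at [c] itself matches the half-open pieces of [step], so that [stepE] holds at every
    point of [Omega], not just almost everywhere. *)
Definition heaviside c x : R := (c <= x)%R%:R.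

Lemma measurable_heaviside c : measurable_fun setT (heaviside c).
Proof.
rewrite (_ : heaviside c = \1_`[c, +oo[%classic); first exact: measurable_indic.
by apply/funext => x; rewrite indicE mem_setE in_itv/= andbT.
Qed.

Definition jump a (i : 'I_n) : R :=
  (a (lift ord0 i))%:~R - (a (widen_ord (leqnSn n) i))%:~R.

Let A a (j : nat) : R := (a (inord j))%:~R.

Let jumpE a i : jump a i = A a i.+1 - A a i.
Proof.
rewrite /jump /A; congr ((a _)%:~R - (a _)%:~R); apply/val_inj.
  by rewrite /= inordK// ltnS.
by rewrite /= inordK// ltnS ltnW.
Qed.

(* Abel summation: each switching point enters through a single summand, so
   that moving [t] moves the step function by independent pieces. *)
Lemma stepE t a x : ordered t -> Omega t0 tf x ->
  step t0 tf t a x = (a ord0)%:~R + \sum_i jump a i * heaviside (t ord0 i) x.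
Proof.
rewrite /Omega/= in_itv/= => ot /andP[x0 xf].
pose H j : R := (node t j <= x)%R%:R.
have H1 : \1_(`]t0, node t 1[%classic) x = 1 - H 1%N.
  rewrite indicE mem_setE in_itv/= x0/= /H leNgt.
  by case: (x < _); rewrite /= ?subr0 ?subrr.
have HS (i : 'I_n) : \1_(`[node t i.+1, node t i.+2[%classic) x = H i.+1 - H i.+2.
  rewrite indicE mem_setE in_itv/= /H.
  have := le_node ot (leqnSn i.+1); set p := node t _; set q := node t _ => pq.
  rewrite ltNge; have [qx|xq] := leP q x; first by rewrite (le_trans pq qx) subrr.
  by rewrite andbT subr0.
have a0 : (a ord0)%:~R = A a 0 by rewrite /A; congr (a _)%:~R; apply/val_inj; rewrite /= inordK.
rewrite /step H1 a0.
transitivity ((1 - H 1%N) * A a 0 +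
    \sum_(i < n) (H i.+1 - H i.+2) * (a (lift ord0 i))%:~R).
  by congr (_ + _); apply: eq_bigr => i _; congr (_ * _); exact: HS.
have -> : \sum_(i < n) (H i.+1 - H i.+2) * (a (lift ord0 i))%:~R =
    \sum_(i < n) jump a i * heaviside (t ord0 i) x -
    \sum_(0 <= i < n) (H i.+2 * A a i.+1 - H i.+1 * A a i).
  rewrite big_mkord -sumrB; apply: eq_bigr => i _.
  rewrite jumpE -nodeS -[heaviside _ _]/(H i.+1).
  rewrite (_ : (a (lift ord0 i))%:~R = A a i.+1).
    by ring.
  by rewrite /A; congr (a _)%:~R; apply/val_inj; rewrite /= inordK// ltnS.
rewrite (telescope_sumr (fun i => H i.+1 * A a i))//.
(* The upper boundary term of the telescoping sum disappears because [x] lies before the last node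
   [tf]. *)
rewrite [H n.+1](_ : _ = 0).
  by ring.
by rewrite /H node_last leNgt xf.
Qed.

(** Let [k] be the largest index of a node not exceeding [x]. Exactly the first [k] jumps are active
    at [x], and they telescope to the value of index [k]. Maximality of [k] settles the case of
    coinciding nodes. *)
Lemma step_value t a x : ordered t -> Omega t0 tf x ->
  exists j, step t0 tf t a x = (a j)%:~R.
Proof.
move=> ot Ox; rewrite stepE//; move: Ox; rewrite /Omega/= in_itv/= => /andP[x0 xf].
have P0 : exists k, node t k <= x by exists 0%N; exact: ltW.
have Pn k : node t k <= x -> (k <= n)%N.
  move=> kx; rewrite leqNgt; apply/negP => nk.
  by have := le_node ot nk; rewrite node_last leNgt (le_lt_trans kx xf).
case: (ex_maxnP P0 Pn) => k kx kmax.
have Hk (i : 'I_n) : heaviside (t ord0 i) x = (i < k)%:R.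
  rewrite /heaviside -nodeS; congr ((nat_of_bool _)%:R); apply/idP/idP; first exact: kmax.
  by move=> ik; exact: le_trans (le_node ot ik) kx.
exists (inord k); rewrite -[RHS]/(A a k).
have kn := Pn _ kx.
have -> : \sum_i jump a i * heaviside (t ord0 i) x = \sum_(0 <= i < k) (A a i.+1 - A a i).
  rewrite (big_nat_widen _ _ n)//= big_mkord [RHS]big_mkcond; apply: eq_bigr => i _.
  by rewrite Hk jumpE; case: (i < k)%N; rewrite ?mulr1 ?mulr0.
rewrite telescope_sumr// addrCA (_ : (a ord0)%:~R = A a 0) ?subrr ?addr0//.
by rewrite /A; congr (a _)%:~R; apply/val_inj; rewrite /= inordK.
Qed.

End step_functions.
Arguments jump {R n} a i.

(** * Integrals and L^1 distances of step functions *)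

Section step_integrals.
Context (R : realType) (t0 tf : R).
Local Notation mu := (mu_Omega t0 tf).
Local Notation leb := (@lebesgue_measure R).
Local Notation L2 := (L2 t0 tf).
Implicit Types (c d x : R) (psi : R -> R).

Lemma mu_Omega_Rintegral psi : measurable_fun setT psi ->
  \int[mu]_x psi x = \int[leb]_(x in Omega t0 tf) psi x.
Proof.
move=> mpsi; congr fine.
have mE : measurable_fun setT (EFin \o psi) by apply/measurable_EFinP.
by rewrite -(@integral_mrestr _ _ _ leb _ (measurable_Omega t0 tf)).
Qed.

(** The difference of Heaviside functions is the indicator of the half-open interval from [c] to
    [d]. The closed interval, which is the one in [mean_left] and [mean_right], and the removal of
    the end points of [Omega] change the integrand at most at [c] and [d]. *)
Lemma integral_band psi c d : measurable_fun setT psi ->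
  t0 <= c -> c <= d -> d <= tf ->
  \int[mu]_x (psi x * (heaviside c x - heaviside d x)) =
  \int[leb]_(x in `[c, d]) psi x.
Proof.
move=> mpsi t0c cd dtf; have mH := @measurable_heaviside R.
rewrite mu_Omega_Rintegral; last first.
  exact: measurable_funM mpsi (measurable_funB (mH c) (mH d)).
rewrite Rintegral_mkcond [RHS]Rintegral_mkcond.
congr fine; apply: ae_eq_integral => //.
- apply/measurable_EFinP/(measurable_restrictT _ (measurable_Omega t0 tf)).
  apply: measurable_funTS.
  exact: measurable_funM mpsi (measurable_funB (mH c) (mH d)).
- apply/measurable_EFinP/(measurable_restrictT _ (measurable_itv `[c, d])).
  exact: measurable_funTS.
exists [set c; d]; split.
- exact/measurableU.
- by apply: countable_lebesgue_measure0; apply: finite_set_countable; exact: finite_set2.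
move=> x /=; apply: contra_notP => /not_orP[/eqP xc /eqP xd] _.
congr EFin; rewrite !patchE /heaviside !mem_setE !in_itv/=.
have [cx|xc'] := leP c x; last first.
  rewrite leNgt (lt_le_trans xc' cd)/= subrr mulr0.
  by case: ifP.
have {}cx : c < x by rewrite lt_neqAle eq_sym xc.
rewrite (le_lt_trans t0c cx)/=.
have [dx|xd'] := leP d x.
  rewrite subrr mulr0 if_same leNgt lt_neqAle eq_sym xd dx//.
by rewrite (lt_le_trans xd' dtf) ltW// subr0 mulr1.
Qed.

Lemma mu_measurable_integrable psi : measurable_fun setT psi ->
  {within `[t0, tf], continuous psi} -> mu.-integrable setT (EFin \o psi).
Proof.
move=> mpsi cpsi; apply/integrableP; split; first exact/measurable_EFinP.
have mE : measurable_fun setT (fun x => `|(psi x)%:E|%E).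
  by apply/measurableT_comp => //; exact/measurable_EFinP.
have -> : (\int[mu]_x `|(psi x)%:E| = \int[leb]_(x in Omega t0 tf) `|(psi x)%:E|)%E.
  by rewrite -(@integral_mrestr _ _ _ leb _ (measurable_Omega t0 tf)).
have /integrableP[_] : leb.-integrable `[t0, tf] (EFin \o psi).
  by apply: continuous_compact_integrable => //; exact: segment_compact.
apply: le_lt_trans; apply: ge0_subset_integral => //.
- exact: measurable_Omega.
- exact: measurable_funTS.
- by apply: subset_itv; rewrite bnd_simp.
Qed.

Lemma heaviside_Lfun c : heaviside c \in Lfun mu 2.
Proof.
apply: (@Lfun2_bounded _ _ _ _ _ 1); first exact: measurable_heaviside.
by move=> x; rewrite /heaviside; case: (c <= x); rewrite ?normr1 ?normr0.
Qed.

Lemma integral_heavisideB c d : t0 <= c <= tf -> t0 <= d <= tf ->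
  \int[mu]_x `|heaviside c x - heaviside d x| = `|c - d|.
Proof.
wlog cd : c d / c <= d => [hw|] ci di.
  have [cd|/ltW dc] := leP c d; first exact: hw.
  by rewrite distrC -hw//; apply: eq_Rintegral => x _; rewrite distrC.
have -> : `|c - d| = \int[leb]_(x in `[c, d]) 1.
  rewrite Rintegral_cst//= lebesgue_measure_itv/= lte_fin mul1r.
  rewrite distrC ger0_norm ?subr_ge0//.
  by move: cd; rewrite le_eqVlt => /orP[/eqP ->|->//]; rewrite ltxx subrr.
move: ci di => /andP[t0c _] /andP[_ dtf].
rewrite -integral_band//; apply: eq_Rintegral => x _.
rewrite mul1r ger0_norm// subr_ge0 /heaviside ler_nat.
by have [dx|] := leP d x => //; rewrite (le_trans cd dx).
Qed.

Context (n : nat).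
Implicit Types (t s : 'rV[R]_n) (a : 'I_n.+1 -> int).
Local Notation ordered := (ordered t0 tf).
Local Notation stepL2 := (stepL2 t0 tf).

Let step_class t a : {ae mu, forall x, stepL2 t a x = step t0 tf t a x}.
Proof. exact: (Lp_classE (Lfun_Sub (lee1n 2) (step_Lfun t0 tf t a))). Qed.

Let ae_Omega (P : R -> Prop) : (forall x, Omega t0 tf x -> P x) ->
  {ae mu, forall x, P x}.
Proof.
by move=> OP; apply: (@ae_mrestr _ _ _ leb _ (measurable_Omega t0 tf)); exact: aeW.
Qed.

#[local] Instance ae_mu : Filter (nbhs (almost_everywhere mu)).
Proof. exact: (@ae_filter_ringOfSetsType _ _ _ mu). Qed.

Lemma stepL2_ae t a : ordered t ->
  {ae mu, forall x, stepL2 t a x =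
     (a ord0)%:~R + \sum_i jump a i * heaviside (t ord0 i) x}.
Proof.
move=> ot; apply: filterS2 (step_class t a) (ae_Omega (fun x Ox => stepE a ot Ox)).
by move=> x -> ->.
Qed.

Lemma stepL2_FP (M : nat) (nu : 'I_M -> int) t a : ordered t ->
  (forall i, exists j, a i = nu j) -> FP nu (stepL2 t a).
Proof.
move=> ot anu; apply: filterS2 (step_class t a) (ae_Omega (fun x Ox => step_value a ot Ox)).
move=> x -> [i ->]; have [j ->] := anu i.
by exists j.
Qed.

Definition step_diff s t a x :=
  \sum_i jump a i * (heaviside (s ord0 i) x - heaviside (t ord0 i) x).

Let step_diff_summand_Lfun s t a (i : 'I_n) :
  (fun x => jump a i * (heaviside (s ord0 i) x - heaviside (t ord0 i) x)) \in Lfun mu 2.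
Proof.
under eq_fun do rewrite mulrBr -mulNr.
by apply: Lfun2D; apply: Lfun2Z; exact: heaviside_Lfun.
Qed.

Lemma step_diff_Lfun s t a : step_diff s t a \in Lfun mu 2.
Proof. exact: Lfun2_sum. Qed.

Lemma stepL2B s t a : ordered s -> ordered t ->
  stepL2 s a - stepL2 t a = L2class mu (step_diff s t a).
Proof.
move=> os ot; apply/esym/L2class_eq; first exact: step_diff_Lfun.
have := Lp_funD (stepL2 s a - stepL2 t a) (stepL2 t a); rewrite subrK.
apply: filterS3 (stepL2_ae a os) (stepL2_ae a ot) => x sE tE h.
transitivity (stepL2 s a x - stepL2 t a x); first by rewrite [stepL2 s a x]h addrK.
rewrite sE tE /step_diff opprD addrACA subrr add0r -sumrB.
by apply: eq_bigr => i _; rewrite mulrBr.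
Qed.

(** The difference is a sum with one term per switching point, so the triangle inequality applies
    even when the displaced intervals overlap. *)
Lemma L1norm_stepB s t a : ordered s -> ordered t ->
  L1norm (stepL2 s a - stepL2 t a) <= \sum_i `|jump a i| * `|s ord0 i - t ord0 i|.
Proof.
move=> os ot; rewrite stepL2B// /L1norm.
rewrite [X in X <= _](Lnorm1_L2class (step_diff_Lfun s t a)).
apply: (le_trans (le_Rintegral_sum _ (step_diff_summand_Lfun s t a))).
apply: ler_sum => i _; under eq_Rintegral do rewrite normrM.
rewrite RintegralZl//; last first.
  apply: (@Lfun2_integrable_norm _ _ _ mu
    (fun x => heaviside (s ord0 i) x - heaviside (t ord0 i) x)).
  under eq_fun do rewrite -mulN1r.
  by apply: Lfun2D; [|apply: Lfun2Z]; exact: heaviside_Lfun.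
by rewrite integral_heavisideB//; exact: t_in_itv.
Qed.

End step_integrals.

(** * Second order expansion *)

Lemma cvg_is_derive (R : realType) (V W : normedModType R) (f : V -> W) (x v : V) (l : W) :
  h^-1 *: (f (h *: v + x) - f x) @[h --> (0 : R)^'] --> l -> is_derive x v f l.
Proof.
by move=> fl; apply: DeriveDef; [apply/cvg_ex; exists l|apply/cvg_lim].
Qed.

Section second_order.
Context (R : realType) (V : normedModType R) (F : V -> R)
  (H : V -> {bilinear V -> V -> R}).
Hypothesis HF : twice_continuously_differentiable F H.

Let is_derive_line v u (s : R) :
  is_derive s 1 (fun s : R => F (v + s *: u)) ('d F (v + s *: u) u).
Proof.
have [dF _ _] := HF.
rewrite -deriveE//; apply: cvg_is_derive.
have := @diff_derivable _ _ _ F (v + s *: u) u (dF _).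
rewrite /derivable /derive; apply: cvg_trans; apply: near_eq_cvg.
apply: nearW => h /=; congr (_ *: (F _ - _)).
by rewrite [h *: 1]mulr1 scalerDl addrCA.
Qed.

Let is_derive_diff_line v u (s : R) :
  is_derive s 1 (fun s : R => 'd F (v + s *: u) u) (H (v + s *: u) u u).
Proof.
have [_ HH _] := HF; have [_ Hxi] := HH (v + s *: u).
apply: cvg_is_derive; apply/cvgrPdist_le => /= e e0.
(* Inserting the increment [h *: u] and the argument [u] turns the Hessian error into this constant
   times [|h| |u|^2], at most [e |h|]; the added 1 covers [u = 0]. *)
have d0 : 0 < e / (`|u| ^+ 2 + 1) by rewrite divr_gt0// ltr_wpDl// sqr_ge0.
have c0 : h *: u @[h --> (0 : R)^'] --> (0 : V).
  rewrite -[X in _ --> X](scale0r u); apply: cvgZr_tmp.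
  exact: nbhs_dnbhs.
near=> h.
have h0 : h != 0 by near: h; exact: nbhs_dnbhs_neq.
have : forall w : V, `|'d F (v + s *: u + h *: u) w - 'd F (v + s *: u) w
    - H (v + s *: u) (h *: u) w| <= e / (`|u| ^+ 2 + 1) * `|h *: u| * `|w|.
  by near: h; exact: (c0 _ (Hxi _ d0)).
move=> /(_ u); rewrite linearZl_LR /= normrZ.
rewrite (_ : v + (h *: 1 + s) *: u = v + s *: u + h *: u); last first.
  by rewrite [h *: 1]mulr1 scalerDl addrCA addrC.
set A := 'd F _ u - 'd F _ u; set L := H _ u u => le.
rewrite (_ : L - h^-1 *: A = - (h^-1 * (A - h * L))); last first.
  by rewrite mulrBr mulKf// opprB.
rewrite normrN normrM normfV ler_pdivrMl ?normr_gt0//.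
apply: (le_trans le); set q := e / _.
have qe : q * `|u| ^+ 2 <= e.
  by rewrite mulrAC ler_pdivrMr ?ltr_wpDl ?sqr_ge0// ler_pM2l// lerDl.
rewrite (_ : q * (`|h| * `|u|) * `|u| = `|h| * (q * `|u| ^+ 2)); last by ring.
by rewrite ler_pM2l ?normr_gt0.
Unshelve. all: by end_near. Qed.

(** The mean value theorem is used twice along the segment: for [F] up to 1, then for the
    directional derivative up to the intermediate point [c]. As [c < 1], the remainder is at most
    [B]; the sharper factor 1/2 would change nothing in the limit [h -> 0]. *)
Lemma le_second_order v u (B : R) : (forall xi, `|H xi u u| <= B) ->
  F (v + u) <= F v + 'd F v u + B.
Proof.
move=> HB; have cont (f df : R -> R) : (forall s : R, is_derive s 1 f (df s)) ->
    forall a b : R, {within `[a, b], continuous f}.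
  move=> fdf a b; apply: continuous_subspaceT => s.
  by apply: differentiable_continuous; apply/derivable1_diffP; have [] := fdf s.
have [c cI] := MVT ltr01 (fun s _ => is_derive_line v u s) (cont _ _ (is_derive_line v u) 0 1).
rewrite scale1r scale0r addr0 subr0 mulr1 => FE.
move: cI; rewrite in_itv/= => /andP[c0 c1].
have [b _] := MVT c0 (fun s _ => is_derive_diff_line v u s)
  (cont _ _ (is_derive_diff_line v u) 0 c).
rewrite scale0r addr0 subr0 => dE.
rewrite -addrA -lerBlDl FE -lerBlDl dE (le_trans (ler_norm _))// normrM.
rewrite (gtr0_norm c0) (le_trans _ (HB (v + b *: u)))// ler_piMr// ltW//.
Qed.

End second_order.

(** * Perturbation of switching points *)

Section one_sided_means.
Context (R : realType).
Implicit Types (f : R -> \bar R) (K : R).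

(** Every right neighbourhood of 0 contains [h] with [K * h] below any given [e], so each supremum
    in the definition is at least [- e]. *)
Lemma limf_esup_ge0_near f K :
  (\forall h \near (0 : R)^'+, ((- (K * h))%:E <= f h)%E) ->
  (0 <= limf_esup f (0 : R)^'+)%E.
Proof.
move=> fK; rewrite limf_esupE; apply: le_ereal_inf_tmp => _ /= [V VF <-].
apply/lee_addgt0Pr => e e0.
have [h [Vh fh h0 hd]] : exists h : R, [/\ V h, ((- (K * h))%:E <= f h)%E, 0 < h
    & h < e / (`|K| + 1)].
  near (0 : R)^'+ => h; exists h; split; near: h => //.
  - exact: nbhs_right_gt.
  - by apply: nbhs_right_lt; rewrite divr_gt0// ltr_wpDl.
rewrite -leeBlDr// sub0e (@le_trans _ _ (f h))//; last first.
  by apply: ereal_sup_ubound; exists h.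
apply: le_trans fh; rewrite lee_fin lerN2.
move: hd; rewrite ltr_pdivlMr ?ltr_wpDl// => /ltW; apply: le_trans.
by rewrite mulrC ler_pM2l// (le_trans (ler_norm _))// lerDl.
Unshelve. all: by end_near. Qed.

Lemma limf_einf_le0_near f K :
  (\forall h \near (0 : R)^'+, (f h <= (K * h)%:E)%E) ->
  (limf_einf f (0 : R)^'+ <= 0)%E.
Proof.
move=> fK; rewrite /limf_einf leeNl oppe0; apply: (@limf_esup_ge0_near _ K).
by apply: filterS fK => h; rewrite /= EFinN leeN2.
Qed.

End one_sided_means.

(** Taking [e] from a right neighbourhood of 0 instead of a minimum also covers an empty index type,
    that is, a step function without switching points. *)
Lemma finite_positive_bound (R : realType) (I : finType) (f : I -> R) :
  (forall i, 0 < f i) -> exists2 e, 0 < e & forall i, e <= f i.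
Proof.
move=> f0; have fe : \forall e \near (0 : R)^'+, forall i, e <= f i.
  by apply: filter_forall => i; exact: nbhs_right_le.
near (0 : R)^'+ => e; exists e; near: e => //; exact: nbhs_right_gt.
Unshelve. all: by end_near. Qed.

(** Neighbourhoods of a matrix are given entry by entry; finitely many entries admit a common
    radius. *)
Lemma near_rVP (R : realType) (n : nat) (t : 'rV[R]_n) (P : set 'rV[R]_n) :
  (\forall s \near t, P s) <->
  exists2 e : R, 0 < e & forall s : 'rV[R]_n, (forall j, `|t ord0 j - s ord0 j| < e) -> P s.
Proof.
split=> [[Q tQ QP]|[e e0 eP]]; last first.
  exists (fun i j => ball (t i j) e) => [i j|s ts]; first exact: nbhsx_ballx.
  by apply: eP => j; exact: ts.
have Qe j : exists e : R, 0 < e /\ ball (t ord0 j) e `<=` Q ord0 j.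
  by have /nbhs_ballP[e] := tQ ord0 j; exists e.
have [f fQ] := choice Qe.
have [e e0 ef] := finite_positive_bound (fun j => (fQ j).1).
exists e => // s ts; apply: QP => i j; rewrite ord1.
by apply: (fQ j).2; apply: (lt_le_trans (ts j)).
Qed.

Section shift.
Context (R : realType) (t0 tf : R) (n : nat).
Local Notation mu := (mu_Omega t0 tf).
Local Notation leb := (@lebesgue_measure R).
Local Notation L2 := (L2 t0 tf).
Local Notation node := (node t0 tf).
Local Notation ordered := (ordered t0 tf).
Local Notation stepL2 := (stepL2 t0 tf).
Implicit Types (t s : 'rV[R]_n) (a : 'I_n.+1 -> int) (g : L2).

Definition shift_node t (i : 'I_n) (h : R) : 'rV[R]_n := t + h *: delta_mx ord0 i.

Lemma shift_nodeE t i h j : shift_node t i h ord0 j = t ord0 j + (if j == i then h else 0).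
Proof. by rewrite !mxE eqxx /=; case: (j == i); rewrite ?mulr1 ?mulr0. Qed.

Lemma near_shift_node t i (P : set 'rV[R]_n) : (\forall s \near t, P s) ->
  \forall h \near (0 : R), P (shift_node t i h).
Proof.
move=> /near_rVP[e e0 eP]; near=> h; apply: eP => j.
rewrite shift_nodeE opprD addrA subrr sub0r normrN.
by case: ifP => _; rewrite ?normr0//; near: h; exact: nbhs0_lt.
Unshelve. all: by end_near. Qed.

Lemma near_ordered t : (forall i : 'I_n.+1, node t i < node t i.+1) ->
  \forall s \near t, ordered s.
Proof.
move=> st; apply/near_rVP.
have [e e0 he] := finite_positive_bound (fun i : 'I_n.+1 => etrans (subr_gt0 _ _) (st i)).
(* Each gap between nodes is at least [e], and its two ends move by less than [e / 2] each. *)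
exists (e / 2); first by rewrite divr_gt0.
move=> s ts i; have nodes j : `|node t j - node s j| < e / 2.
  case: j => [|j] /=; first by rewrite subrr normr0 divr_gt0.
  by case: insubP => [k _ _|_] /=; [exact: ts|rewrite subrr normr0 divr_gt0].
have := he i; have := nodes i; have := nodes i.+1.
move: (node t i) (node t i.+1) (node s i) (node s i.+1) => p q p' q'.
rewrite !ltr_norml => /andP[a b] /andP[c d] ?; lra.
Qed.

Lemma step_diff_shift t a i h : step_diff (shift_node t i h) t a =
  fun x => jump a i * (heaviside (t ord0 i + h) x - heaviside (t ord0 i) x).
Proof.
apply/funext => x; rewrite /step_diff (bigD1 i)//= big1 ?addr0.
  by rewrite shift_nodeE eqxx.
by move=> j /negbTE ji; rewrite shift_nodeE ji addr0 subrr mulr0.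
Qed.

Let inner_shift g t a i h : ordered t -> ordered (shift_node t i h) ->
  inner g (stepL2 (shift_node t i h) a - stepL2 t a) =
  jump a i * \int[mu]_x (g x * (heaviside (t ord0 i + h) x - heaviside (t ord0 i) x)).
Proof.
move=> ot os; rewrite stepL2B// [LHS](ip_L2class g (step_diff_Lfun t0 tf (shift_node t i h) t a)).
rewrite step_diff_shift; under eq_Rintegral do rewrite mulrCA.
rewrite RintegralZl//.
apply: (@Lfun2_integrableM _ _ _ mu); first exact: (Lp_Lfun (g : Lp mu _)).
by under eq_fun do rewrite -mulN1r;
   apply: Lfun2D; [|apply: Lfun2Z]; exact: heaviside_Lfun.
Qed.

(** Moving a switching point to the right lets the old value last longer, whence the minus sign;
    moving it to the left lets the new value start earlier, whence the plus sign in
    [inner_shift_left]. *)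
Lemma inner_shift_right g t a i h : ordered t -> ordered (shift_node t i h) -> 0 <= h ->
  inner g (stepL2 (shift_node t i h) a - stepL2 t a) =
  - (jump a i * \int[leb]_(x in `[t ord0 i, t ord0 i + h]) g x).
Proof.
move=> ot os h0; rewrite inner_shift// -mulrN; congr (_ * _).
have /andP[ti _] := t_in_itv i ot.
have := t_in_itv i os; rewrite shift_nodeE eqxx => /andP[_ thi].
have mg : measurable_fun setT (g : R -> R) := Lp_measurable (g : Lp mu _).
rewrite -(@integral_band _ t0 tf) ?lerDl//.
rewrite -mulN1r -RintegralZl//; last first.
  apply: (@Lfun2_integrableM _ _ _ mu); first exact: (Lp_Lfun (g : Lp mu _)).
  by under eq_fun do rewrite -mulN1r;
     apply: Lfun2D; [|apply: Lfun2Z]; exact: heaviside_Lfun.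
by apply: eq_Rintegral => x _; rewrite mulrCA mulN1r opprB.
Qed.

Lemma inner_shift_left g t a i h : ordered t -> ordered (shift_node t i (- h)) -> 0 <= h ->
  inner g (stepL2 (shift_node t i (- h)) a - stepL2 t a) =
  jump a i * \int[leb]_(x in `[t ord0 i - h, t ord0 i]) g x.
Proof.
move=> ot os h0; rewrite inner_shift//; congr (_ * _).
have /andP[_ ti] := t_in_itv i ot.
have := t_in_itv i os; rewrite shift_nodeE eqxx => /andP[thi _].
have mg : measurable_fun setT (g : R -> R) := Lp_measurable (g : Lp mu _).
by rewrite (@integral_band _ t0 tf) ?gerBl.
Qed.

Lemma L1norm_shift t a i h : ordered t -> ordered (shift_node t i h) ->
  L1norm (stepL2 (shift_node t i h) a - stepL2 t a) <= `|jump a i| * `|h|.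
Proof.
move=> ot os; apply: (le_trans (L1norm_stepB _ os ot)).
rewrite (bigD1 i)//= big1 ?addr0.
  by rewrite shift_nodeE eqxx addrAC subrr add0r.
by move=> j /negbTE ji; rewrite shift_nodeE ji addr0 subrr normr0 mulr0.
Qed.

(** Strict order of [t] makes small shifts in both directions admissible. Dividing by [h] gives an
    upper bound [K i * h] on the jump times the right mean, and a lower bound [- (K i * h)] on the
    jump times the left mean. *)
Lemma L_stationary_criterion (F : L2 -> R) t a (K : 'I_n -> R) :
  (forall i : 'I_n.+1, node t i < node t i.+1) ->
  (forall i, \forall h \near (0 : R), ordered (shift_node t i h) ->
     0 <= inner (grad F (stepL2 t a)) (stepL2 (shift_node t i h) a - stepL2 t a) + K i * h ^+ 2) ->
  L_stationary F (stepL2 t a) t a.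
Proof.
move=> st HK; pose g := grad F (stepL2 t a).
have ot : ordered t by move=> i; exact/ltW.
have near_h i : \forall h \near (0 : R)^'+, 0 < h /\
    (jump a i * (h^-1 * \int[leb]_(x in `[t ord0 i, t ord0 i + h]) g x) <= K i * h) /\
    (- (K i * h) <= jump a i * (h^-1 * \int[leb]_(x in `[t ord0 i - h, t ord0 i]) g x)).
  have [e /= e0 he] : exists2 e : R, 0 < e & forall h, `|h| < e ->
      ordered (shift_node t i h) /\
      0 <= inner g (stepL2 (shift_node t i h) a - stepL2 t a) + K i * h ^+ 2.
    have : \forall h \near (0 : R), ordered (shift_node t i h) /\
        0 <= inner g (stepL2 (shift_node t i h) a - stepL2 t a) + K i * h ^+ 2.
      apply: filterS2 (near_shift_node i (near_ordered st)) (HK i) => h os /(_ os).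
      by [].
    move=> /nbhs_ballP[e e0 he]; exists e => // h hlt; apply: he.
    by rewrite /ball/= sub0r normrN.
  near=> h.
  have h0 : 0 < h by near: h; exact: nbhs_right_gt.
  have hlt : `|h| < e by rewrite gtr0_norm//; near: h; exact: nbhs_right_lt.
  split=> //; split.
    have [os] := he h hlt; rewrite inner_shift_right//.
    by rewrite addrC subr_ge0 => le; rewrite mulrCA ler_pdivrMl// mulrCA -expr2.
  have [|os] := he (- h); first by rewrite normrN.
  rewrite inner_shift_left//.
  rewrite sqrrN addrC -lerBlDl sub0r => le.
  by rewrite mulrCA ler_pdivlMl// mulrN mulrCA -expr2.
move=> i /=; rewrite -/g; split => aa.
  have j0 : (0 : R) < jump a i by rewrite /jump subr_gt0 ltr_int.
  split.
    apply: (@limf_esup_ge0_near _ _ (K i / jump a i)).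
    apply: filterS (near_h i) => h [_ [_ le]].
    rewrite /mean_left lee_fin -(ler_pM2l j0) (le_trans _ le)// le_eqVlt.
    by apply/orP; left; apply/eqP; field; rewrite gt_eqF.
  apply: (@limf_einf_le0_near _ _ (K i / jump a i)).
  apply: filterS (near_h i) => h [_ [le _]].
  rewrite /mean_right lee_fin -(ler_pM2l j0) (le_trans le)// le_eqVlt.
  by apply/orP; left; apply/eqP; field; rewrite gt_eqF.
(* Dividing by a negative jump reverses both inequalities: upper and lower limits trade places and
   the constant becomes [- K i / jump a i]. *)
have j0 : jump a i < (0 : R) by rewrite /jump subr_lt0 ltr_int.
split.
  apply: (@limf_einf_le0_near _ _ (- K i / jump a i)).
  apply: filterS (near_h i) => h [_ [_ le]].
  rewrite /mean_left lee_fin -(ler_nM2l j0) (le_trans _ le)// le_eqVlt.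
  by apply/orP; left; apply/eqP; field; rewrite lt_eqF.
apply: (@limf_esup_ge0_near _ _ (- K i / jump a i)).
apply: filterS (near_h i) => h [_ [le _]].
rewrite /mean_right lee_fin -(ler_nM2l j0) (le_trans le)// le_eqVlt.
by apply/orP; left; apply/eqP; field; rewrite lt_eqF.
Unshelve. all: by end_near. Qed.

End shift.

(** * Test functions and total variation *)

Section bumps.
Context (R : realType).
Implicit Types (f g : R -> R) (x h : R).

(** This form differentiates the squared positive part across its kink at 0 by mere case analysis on
    signs. *)
Lemma is_derive_quadratic_error f x (l : R) :
  (forall h, `|f (h + x) - f x - h * l| <= h ^+ 2) -> is_derive x 1 f l.
Proof.
move=> fl; apply: cvg_is_derive; apply/cvgrPdist_le => /= e e0; near=> h.
have h0 : h != 0 by near: h; exact: nbhs_dnbhs_neq.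
rewrite [h *: 1]mulr1 (_ : l - _ = - (h^-1 * (f (h + x) - f x - h * l))); last first.
  by rewrite [_ *: _]/(_ * _) mulrBr mulKf// opprB.
rewrite normrN normrM normfV ler_pdivrMl ?normr_gt0// (le_trans (fl h))//.
rewrite -[leLHS]real_normK ?num_real// expr2 ler_pM2l ?normr_gt0//.
by near: h; exact: dnbhs0_le.
Unshelve. all: by end_near. Qed.

Definition C1 f := (forall x, derivable f x 1) /\ continuous (derive1 f).

Lemma C1_cst (c : R) : C1 (fun=> c).
Proof.
split=> [x|]; first exact: derivable_cst.
rewrite (_ : derive1 _ = fun=> 0); first exact: cst_continuous.
by apply/funext => x; rewrite derive1_cst.
Qed.

Lemma C1D f g : C1 f -> C1 g -> C1 (fun x => f x + g x).
Proof.
move=> [df cf] [dg cg]; split=> [x|]; first exact: derivableD.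
rewrite (_ : derive1 _ = fun x => derive1 f x + derive1 g x).
  by move=> x; apply: cvgD; [exact: cf|exact: cg].
by apply/funext => x; rewrite !derive1E; apply: deriveD.
Qed.

Lemma C1Z (c : R) f : C1 f -> C1 (fun x => c * f x).
Proof.
move=> [df cf]; split=> [x|]; first exact: (derivableZ (k := c)).
rewrite (_ : derive1 _ = fun x => c * derive1 f x).
  by move=> x; apply: cvgM; [exact: cvg_cst|exact: cf].
by apply/funext => x; rewrite !derive1E; apply: (deriveZ c).
Qed.

Lemma C1_sum (I : Type) (r : seq I) (f : I -> R -> R) : (forall i, C1 (f i)) ->
  C1 (fun x => \sum_(i <- r) f i x).
Proof.
move=> Cf; elim: r => [|i r IH].
  by under eq_fun do rewrite big_nil; exact: C1_cst.
by under eq_fun do rewrite big_cons; exact: C1D.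
Qed.

(** Written with the absolute value so that continuity reduces to that of the norm. *)
Definition pos_part x : R := (x + `|x|) / 2.

Lemma pos_part_ge0E x : 0 <= x -> pos_part x = x.
Proof. by move=> x0; rewrite /pos_part ger0_norm//; lra. Qed.

Lemma pos_part_le0E x : x <= 0 -> pos_part x = 0.
Proof. by move=> x0; rewrite /pos_part ler0_norm//; lra. Qed.

(** Squaring the positive part of a parabola smooths its corners just enough for a continuous
    derivative, which is all that [test_function] asks for. *)
Definition bump (c r x : R) : R := pos_part (1 - ((x - c) / r) ^+ 2) ^+ 2.

Let is_derive_pos_part_sqr x : is_derive x 1 (fun y => pos_part y ^+ 2) (2 * pos_part x).
Proof.
apply: is_derive_quadratic_error => h; rewrite ler_norml.
have [x0|/ltW x0] := leP 0 x; have [hx|/ltW hx] := leP 0 (h + x);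
  rewrite ?(pos_part_ge0E x0) ?(pos_part_le0E x0) ?(pos_part_ge0E hx) ?(pos_part_le0E hx);
  apply/andP; split; nra.
Qed.

Let bump' c r x : R :=
  2 * pos_part (1 - ((x - c) / r) ^+ 2) * (- (2 * ((x - c) / r) * r^-1)).

Let is_derive_bump c r x : is_derive x 1 (bump c r) (bump' c r x).
Proof.
have d1 : is_derive x 1 (fun y : R => 1 - ((y - c) / r) ^+ 2) (- (2 * ((x - c) / r) * r^-1)).
  apply: is_derive_eq.
  by rewrite /GRing.scale /=; ring.
exact: (@is_derive1_comp _ (fun y => pos_part y ^+ 2) _ x _ _ (is_derive_pos_part_sqr _) d1).
Qed.

Lemma C1_bump c r : C1 (bump c r).
Proof.
split=> [x|]; first by have [] := is_derive_bump c r x.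
rewrite (_ : derive1 _ = bump' c r); last first.
  by apply/funext => x; rewrite derive1E; have [] := is_derive_bump c r x.
move=> x; rewrite /bump' /pos_part.
have c1 : (y - c) / r @[y --> x] --> (x - c) / r.
  by apply: cvgM; [apply: cvgB; [exact: cvg_id|exact: cvg_cst]|exact: cvg_cst].
have c2 : 1 - ((y - c) / r) ^+ 2 @[y --> x] --> 1 - ((x - c) / r) ^+ 2.
  by apply: cvgB; [exact: cvg_cst|exact: cvgM].
have cc (k : R) : k @[y --> x] --> k by exact: cvg_cst.
apply: cvgM.
  by apply: cvgM => //; apply: cvgM => //; apply: cvgD => //; exact: cvg_norm.
apply: cvgN; apply: cvgM => //; exact: cvgM.
Qed.

Lemma bump_center c r : bump c r c = 1.
Proof. by rewrite /bump subrr mul0r expr0n/= subr0 pos_part_ge0E ?expr1n. Qed.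

Lemma bump_eq0 c r x : 0 < r -> r <= `|x - c| -> bump c r x = 0.
Proof.
move=> r0 rx; rewrite /bump pos_part_le0E ?expr0n// subr_le0.
rewrite -(normr_id (x - c)) in rx.
rewrite -[X in _ <= X]real_normK ?num_real// normrM normfV (gtr0_norm r0).
by rewrite -[X in X <= _](expr1n _ 2) lerXn2r ?nnegrE ?divr_ge0 ?(ltW r0)//
  ler_pdivlMr// mul1r -(normr_id (x - c)).
Qed.

Lemma bump_le1 c r x : 0 <= bump c r x <= 1.
Proof.
rewrite /bump sqr_ge0/=; set y := (_ / r) ^+ 2; have y0 : 0 <= y by exact: sqr_ge0.
have [y1|/ltW y1] := leP 0 (1 - y).
  by rewrite pos_part_ge0E// exprn_ile1// gerBl.
by rewrite pos_part_le0E// expr0n.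
Qed.

End bumps.

Section interpolation.
Context (R : realType) (t0 tf : R).

(** A sum of bumps of radius [r], where [2 * r] is at most every gap between points and to the ends
    of the interval. At most one bump is active at any point, which preserves the bound 1, and the
    support stays at distance [r] from both ends. *)
Lemma test_function_interpolation (n : nat) (t p : 'I_n -> R) : t0 < tf ->
  injective t -> (forall i, t0 < t i < tf) -> (forall i, `|p i| <= 1) ->
  exists phi : R -> R, [/\ test_function t0 tf phi, forall x, `|phi x| <= 1
    & forall i, phi (t i) = p i].
Proof.
move=> t0tf tinj tO p1.
have [r r0 [rt0 rtf rt]] : exists2 r, 0 < r & [/\ (forall i, t0 + 2 * r <= t i),
    (forall i, t i + 2 * r <= tf) & forall i j, i != j -> 2 * r <= `|t i - t j|].
  have [e1 e10 h1] : exists2 e, 0 < e & forall i, e <= t i - t0.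
    by apply: finite_positive_bound => i; rewrite subr_gt0; have /andP[] := tO i.
  have [e2 e20 h2] : exists2 e, 0 < e & forall i, e <= tf - t i.
    by apply: finite_positive_bound => i; rewrite subr_gt0; have /andP[] := tO i.
  (* The value 1 on the diagonal is a placeholder that keeps the family positive. *)
  have [e3 e30 h3] : exists2 e, 0 < e & forall ij : 'I_n * 'I_n,
      e <= if ij.1 == ij.2 then 1 else `|t ij.1 - t ij.2|.
    apply: finite_positive_bound => -[i j] /=; case: eqVneq => // ij.
    by rewrite normr_gt0 subr_eq0 (inj_eq tinj).
  exists (Num.min e1 (Num.min e2 e3) / 2).
    by rewrite divr_gt0// !lt_min e10 e20.
  have e (x : R) : 2 * (x / 2) = x by field.
  split=> [i|i|i j ij]; rewrite e.
  - by rewrite -lerBrDl ge_min h1.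
  - by rewrite -lerBrDl !ge_min h2 orbT.
  - by have := h3 (i, j); rewrite /= (negbTE ij) !ge_min => ->; rewrite !orbT.
pose phi x := \sum_(i < n) p i * bump (t i) r x.
have phi0 x : (forall i, r <= `|x - t i|) -> phi x = 0.
  by move=> far; rewrite /phi big1// => i _; rewrite bump_eq0// mulr0.
have phi1 x i : `|x - t i| < r -> phi x = p i * bump (t i) r x.
  move=> near; rewrite /phi (bigD1 i)//= big1 ?addr0// => j ji.
  rewrite bump_eq0 ?mulr0//; have := rt _ _ ji.
  have := ler_distD x (t j) (t i); rewrite (distrC (t j) x); lra.
have supp : closure [set x | phi x != 0] `<=` `[t0 + r, tf - r].
  rewrite [X in _ `<=` X](closure_id _).1; last exact: interval_closed.
  apply: closure_subset => x /= phix; rewrite in_itv/=.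
  have [i] : exists i, `|x - t i| < r.
    apply: contrapT => far; move/eqP: phix; apply; apply: phi0 => i.
    by rewrite leNgt; apply/negP => near; apply: far; exists i.
  rewrite ltr_norml; have := rt0 i; have := rtf i => ? ? /andP[? ?].
  by apply/andP; split; lra.
exists phi; split.
- have [dphi cphi] : C1 phi.
    by apply: C1_sum => i; apply: C1Z; exact: C1_bump.
  split; [exact: dphi|exact: cphi| |].
    apply: (subclosed_compact _ (@segment_compact _ (t0 + r) (tf - r))) => //.
    exact: closed_closure.
  apply: (subset_trans supp) => x /=; rewrite /Omega/= !in_itv/= => /andP[? ?].
  by apply/andP; split; lra.
- move=> x; have [[i near]|far] := pselect (exists i, `|x - t i| < r).
    rewrite (phi1 _ _ near) normrM mulr_ile1//.
    by have /andP[b0 b1] := bump_le1 (t i) r x; rewrite ger0_norm.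
  rewrite phi0 ?normr0// => i; rewrite leNgt; apply/negP => near.
  by apply: far; exists i.
- by move=> i; rewrite (phi1 _ i) ?bump_center ?mulr1// subrr normr0.
Qed.

End interpolation.

Lemma Rintegral_sum d (T : measurableType d) (R : realType)
    (mu : {measure set T -> \bar R}) (I : Type) (r : seq I) (f : I -> T -> R) :
  (forall i, mu.-integrable setT (EFin \o f i)) ->
  \int[mu]_x (\sum_(i <- r) f i x) = \sum_(i <- r) \int[mu]_x f i x.
Proof.
move=> fi; elim: r => [|i r IH].
  rewrite big_nil; under eq_Rintegral do rewrite big_nil.
  by rewrite Rintegral_cst// mul0r.
rewrite big_cons -IH; under eq_Rintegral do rewrite big_cons.
rewrite RintegralD//.
rewrite (_ : EFin \o _ = fun x => (\sum_(j <- r) (f j x)%:E)%E); last first.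
  by apply/funext => x /=; rewrite sumEFin.
by apply: (integrable_sum measurableT) => j _; exact: fi.
Qed.

(** * Total variation of step functions *)

Section total_variation.
Context (R : realType) (t0 tf : R) (n : nat).
Local Notation mu := (mu_Omega t0 tf).
Local Notation leb := (@lebesgue_measure R).
Local Notation L2 := (L2 t0 tf).
Local Notation node := (node t0 tf).
Local Notation ordered := (ordered t0 tf).
Local Notation stepL2 := (stepL2 t0 tf).
Implicit Types (t s : 'rV[R]_n) (a : 'I_n.+1 -> int) (phi : R -> R).

Lemma Rintegral_derive1 phi c d : (forall x, derivable phi x 1) ->
  continuous (derive1 phi) -> c <= d ->
  \int[leb]_(x in `[c, d]) derive1 phi x = phi d - phi c.
Proof.
move=> dphi cphi; rewrite le_eqVlt => /orP[/eqP <-|cd].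
  by rewrite set_itv1 Rintegral_set1 subrr.
have contphi : continuous phi.
  by move=> x; apply: differentiable_continuous; exact/derivable1_diffP.
have FTC : (\int[leb]_(x in `[c, d]) (derive1 phi x)%:E = (phi d)%:E - (phi c)%:E)%E.
  apply: (@continuous_FTC2 _ (derive1 phi) phi c d cd).
  - exact: continuous_subspaceT.
  - split=> [x _||]; first exact: dphi.
      by apply: cvg_at_right_filter; exact: contphi.
    by apply: cvg_at_left_filter; exact: contphi.
  - by [].
by rewrite /Rintegral FTC.
Qed.

Let test_support phi x : test_function t0 tf phi -> ~ Omega t0 tf x -> phi x = 0.
Proof.
move=> [_ _ _ sub] Ox; apply: contrapT => /eqP px; apply: Ox; apply: sub.
exact: subset_closure.
Qed.

(** The distributional derivative of a step function is the sum of Dirac masses at the switching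
    points weighted by the jumps. *)
Lemma integral_step_test t a phi : ordered t -> test_function t0 tf phi ->
  \int[mu]_x (stepL2 t a x * derive1 phi x) = - \sum_i jump a i * phi (t ord0 i).
Proof.
move=> ot Tphi; have [dphi cphi _ _] := Tphi.
have t0tf : t0 <= tf by rewrite -(node_last t0 tf t); exact: (le_node ot (leq0n n.+1)).
have mphi : measurable_fun setT (derive1 phi) by exact: continuous_measurable_fun.
have ptf : phi tf = 0 by apply: (test_support Tphi); rewrite /Omega/= in_itv/= ltxx andbF.
have pt0 : phi t0 = 0 by apply: (test_support Tphi); rewrite /Omega/= in_itv/= ltxx.
(* On [Omega] the function [heaviside tf] is 0 and [heaviside t0] is 1. Subtracting the former
   yields bands for the fundamental theorem of calculus, and the constant first value becomes the
   band from [t0], which contributes [phi t0 = 0]. *)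
have band c : t0 <= c <= tf ->
    \int[mu]_x (derive1 phi x * (heaviside c x - heaviside tf x)) = - phi c.
  move=> /andP[t0c ctf]; rewrite integral_band// Rintegral_derive1//.
  by rewrite ptf sub0r.
have phiL : derive1 phi \in Lfun mu 2.
  apply: (@Lfun2P _ _ _ mu) => //; apply: mu_measurable_integrable.
    exact: measurable_funX.
  by apply: continuous_subspaceT => x; apply: cvgM; exact: cphi.
have bandi c : mu.-integrable setT
    (EFin \o (fun x => derive1 phi x * (heaviside c x - heaviside tf x))).
  apply: (@Lfun2_integrableM _ _ _ mu) => //.
  by under eq_fun do rewrite -mulN1r;
     apply: Lfun2D; [|apply: Lfun2Z]; exact: heaviside_Lfun.
pose f i x := jump a i * (derive1 phi x * (heaviside (t ord0 i) x - heaviside tf x)).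
have fi i : mu.-integrable setT (EFin \o f i).
  exact: (integrableZl measurableT _ (bandi _)).
pose f0 x := (a ord0)%:~R * (derive1 phi x * (heaviside t0 x - heaviside tf x)).
have f0i : mu.-integrable setT (EFin \o f0).
  exact: (integrableZl measurableT _ (bandi _)).
have sfi : mu.-integrable setT (EFin \o (fun x => \sum_i f i x)).
  rewrite (_ : EFin \o _ = fun x => (\sum_i (f i x)%:E)%E); last first.
    by apply/funext => x /=; rewrite sumEFin.
  by apply: (integrable_sum measurableT) => i _; exact: fi.
transitivity (\int[mu]_x (f0 x + \sum_i f i x)).
  apply: (@eq_ae_Rintegral _ _ _ mu).
  - by apply: measurable_funM => //; exact: (Lp_measurable (stepL2 t a : Lp mu _)).
  - apply: measurable_funD; apply/measurable_EFinP.
      exact: measurable_int f0i.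
    exact: measurable_int sfi.
  have inO : {ae mu, forall x, Omega t0 tf x}.
    by apply: (@ae_mrestr _ _ _ leb _ (measurable_Omega t0 tf)); exact: aeW.
  apply: (@filterS2 _ _ (@ae_filter_ringOfSetsType _ _ _ mu) _ _ _ _ (stepL2_ae a ot) inO).
  move=> x sE; rewrite /Omega/= in_itv/= => /andP[x0 xf].
  rewrite [stepL2 t a x]sE mulrDl mulr_suml /f0 /f.
  have -> : heaviside t0 x = 1 by rewrite /heaviside ltW.
  have -> : heaviside tf x = 0 by rewrite /heaviside leNgt xf.
  rewrite subr0 mulr1; congr (_ + _); apply: eq_bigr => i _.
  by rewrite subr0 mulrA mulrAC.
rewrite RintegralD// Rintegral_sum// RintegralZl// band ?lexx//.
rewrite pt0 oppr0 mulr0 add0r -sumrN; apply: eq_bigr => i _.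
by rewrite RintegralZl// band ?mulrN//; exact: t_in_itv.
Qed.

(* A test function [phi] for [s] is matched by one for [t] taking the value
   [phi (s i)] at [t i]; neither total variation needs to be computed. *)
Lemma TV_stepL2_le s t a : (forall i : 'I_n.+1, node t i < node t i.+1) ->
  ordered s -> (TV t0 tf (stepL2 s a) <= TV t0 tf (stepL2 t a))%E.
Proof.
move=> st os; have ot : ordered t by move=> i; exact/ltW.
have lt_node i j : (i < j <= n.+1)%N -> node t i < node t j.
  move=> /andP[ij jn]; apply: (lt_le_trans (st (Ordinal (leq_trans ij jn)))).
  exact: (le_node ot ij).
have t0tf : t0 < tf.
  by rewrite -(node_last t0 tf t); exact: (lt_node 0%N n.+1 (leqnn _)).
apply: ub_ereal_sup => _ /= [phi [Tphi phi1] <-].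
have tinj : injective (fun i => t ord0 i).
  move=> i j tij; apply/val_inj; case: (ltngtP i j) => // ij.
    have := lt_node i.+1 j.+1; rewrite ltnS ij (leqW (ltn_ord j)) => /(_ isT).
    by rewrite !nodeS tij ltxx.
  have := lt_node j.+1 i.+1; rewrite ltnS ij (leqW (ltn_ord i)) => /(_ isT).
  by rewrite !nodeS tij ltxx.
have tO i : t0 < t ord0 i < tf.
  rewrite -(nodeS t0 tf t); apply/andP; split.
    exact: (lt_node 0%N i.+1 (leqW (ltn_ord i))).
  rewrite -[ltRHS](node_last t0 tf t).
  by apply: (lt_node i.+1 n.+1); rewrite !ltnS ltn_ord leqnn.
(* Equal values at coinciding points of [s] can be prescribed at distinct points of [t], but not
   conversely; hence strict order is asked of [t] alone. *)
have [psi [Tpsi psi1 psit]] :=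
  test_function_interpolation t0tf tinj tO (fun i => phi1 (s ord0 i)).
rewrite integral_step_test//.
apply: ereal_sup_ubound; exists psi => //; rewrite integral_step_test//.
by congr ((- _)%:E); apply: eq_bigr => i _; rewrite psit.
Qed.

End total_variation.

(** * Optimality conditions *)

(** By convexity the difference quotients at [v] towards [w] with step at most 1 never exceed
    [F w - F v], so neither does their limit. *)
Lemma convex_diff_le (R : realType) (V : normedModType R) (F : V -> R) (v w : V) :
  convex_function [set: convex_lmodType V] F -> differentiable F v ->
  F v + 'd F v (w - v) <= F w.
Proof.
move=> cF dF; rewrite -lerBrDl leNgt; apply/negP => lt.
have := @diff_derivable _ _ _ F v (w - v) dF.
rewrite -deriveE// in lt.
move=> /cvg_ex[l dl]; have dE : 'D_(w - v) F v = l by exact/cvg_lim.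
rewrite dE in lt; have near_gtr : \forall h \near (0 : R)^'+,
    F w - F v < h^-1 *: ((F \o shift v) (h *: (w - v)) - F v).
  by move/cvg_dnbhs_at_right/cvgr_gt: dl; apply.
have [h [h0 h1 hgt]] : exists h : R, [/\ 0 < h, h <= 1
    & F w - F v < h^-1 *: ((F \o shift v) (h *: (w - v)) - F v)].
  near (0 : R)^'+ => h; exists h; split; near: h => //.
  - exact: nbhs_right_gt.
  - exact: nbhs_right_le.
have := cF (Itv01 (ltW h0) h1) w v.
have -> : conv (Itv01 (ltW h0) h1) (w : convex_lmodType V) v = h *: (w - v) + v.
  rewrite -[LHS]/(h *: w + (1 - h) *: v) scalerBl scale1r scalerBr addrA.
  by rewrite addrAC.
move=> /(_ (in_setT _) (in_setT _)) cle.
have le : F (h *: (w - v) + v) <= h * F w + (1 - h) * F v := cle.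
move: hgt; rewrite [_ *: _]/(_ * _) ltr_pdivlMl//= ltNge => /negP; apply.
by rewrite lerBlDr (le_trans le)// le_eqVlt; apply/orP; left; apply/eqP; ring.
Unshelve. all: by end_near. Qed.

Section control_theory.
Context (R : realType) (t0 tf : R).
Local Notation mu := (mu_Omega t0 tf).
Local Notation L2 := (L2 t0 tf).
Local Notation node := (node t0 tf).
Local Notation ordered := (ordered t0 tf).
Local Notation stepL2 := (stepL2 t0 tf).
Implicit Types (F : L2 -> R) (v w : L2).

(** The Riesz representation shows that the set from which [grad] chooses is inhabited, so the dummy
    value is not taken. *)
Lemma grad_inner F v w : differentiable F v -> 'd F v w = inner (grad F v) w.
Proof.
move=> dF; have [K _ dK] := linear_lipschitz (diff_continuous dF).
have [g gE] := @Riesz_representation _ _ _ mu ('d F v : Lp mu _ -> R) K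
  (linearD _) (fun c u => linearZ_LR _ c u) dK.
have gex : exists g : L2, forall w : L2, 'd F v w = inner g w by exists g.
exact: (xgetPex 0 gex).
Qed.

Lemma innerr0 (g : L2) : inner g 0 = 0.
Proof. by have := @ipZr _ _ _ mu g 0 0; rewrite scale0r mul0r. Qed.

Lemma L1normBC (u w : L2) : L1norm (u - w) = L1norm (w - u).
Proof. exact: (@Lnorm1_subC _ _ _ mu). Qed.

(** The supremum ranges over a nonempty set, as interpolation at no points shows. With the upper
    bound from [BV] the total variation of [v] is finite and can be cancelled. *)
Lemma TV_gtNy (u : R -> R) : t0 < tf -> (-oo < TV t0 tf u)%E.
Proof.
move=> t0tf; have i0 : forall i : 'I_0, False by case.
have [phi [Tphi phi1 _]] := @test_function_interpolation R t0 tf 0 (fun=> 0) (fun=> 0) t0tf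
  (fun i => False_ind _ (i0 i)) (fun i => False_ind _ (i0 i)) (fun i => False_ind _ (i0 i)).
apply: (@lt_le_trans _ _ (\int[mu]_x (u x * derive1 phi x))%:E); first exact: ltNyr.
by apply: ereal_sup_ubound; exists phi.
Qed.

Context (n : nat).
Implicit Types (t s : 'rV[R]_n) (a : 'I_n.+1 -> int).

Lemma near_L1norm_step t a (r : R) : ordered t -> 0 < r ->
  \forall s \near t, ordered s -> L1norm (stepL2 t a - stepL2 s a) <= r.
Proof.
move=> ot r0; set J : R := \sum_i `|jump a i|.
have J0 : 0 <= J by apply: sumr_ge0.
(* Displacements below this radius cost at most [J * (r / (J + 1))], hence at most [r]; the added 1
   avoids division by 0 when there is no jump. *)
apply/near_rVP; exists (r / (J + 1)); first by rewrite divr_gt0// ltr_wpDl.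
move=> s ts os; apply: (le_trans (L1norm_stepB a ot os)).
apply: (@le_trans _ _ (J * (r / (J + 1)))).
  rewrite /J mulr_suml; apply: ler_sum => i _.
  by rewrite ler_wpM2l// ltW.
by rewrite mulrA ler_pdivrMr ?ltr_wpDl// mulrC ler_pM2l// lerDl.
Qed.

Lemma local_minimizer_L_stationary F t a :
  (forall i : 'I_n.+1, node t i < node t i.+1) -> hessian_assumption F ->
  L_local_minimizer F a t -> L_stationary F (stepL2 t a) t a.
Proof.
move=> st [H HF [C C0 HC]] [ot Fmin]; have [dF _ _] := HF.
(* A shift by [h] has L^1 norm at most [|jump a i| * |h|], so (H) bounds the second order term by
   this constant times [h ^+ 2]. *)
apply: (@L_stationary_criterion _ _ _ _ _ _ _ (fun i => C * jump a i ^+ 2)) => // i.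
have := near_shift_node i Fmin; apply: filterS => h Fh os; have := Fh os.
set u := stepL2 (shift_node t i h) a - stepL2 t a.
have -> : stepL2 (shift_node t i h) a = stepL2 t a + u by rewrite addrC subrK.
have L1u0 : 0 <= L1norm u by apply: fine_ge0; exact: Lnorm_ge0.
have L1u : L1norm u <= `|jump a i| * `|h| by exact: L1norm_shift.
have HB xi : `|H xi u u| <= C * (jump a i ^+ 2 * h ^+ 2).
  apply: (le_trans (HC xi u u)); rewrite -mulrA ler_pM2l//.
  rewrite -[jump a i ^+ 2]real_normK ?num_real// -[h ^+ 2]real_normK ?num_real//.
  by rewrite -exprMn -expr2 lerXn2r// nnegrE mulr_ge0.
move=> Fle; have := le_trans Fle (le_second_order HF (stepL2 t a) HB).
by rewrite -addrA lerDl grad_inner// mulrA.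
Qed.

End control_theory.

Section fixed_values.
Context (R : realType) (t0 tf : R) (t0_lt_tf : t0 < tf) (M : nat) (nu : 'I_M -> int).
Local Notation L2 := (L2 t0 tf).
Implicit Types (F : L2 -> R) (v w : L2).

(** The objective vanishes at [v] itself. Finiteness of the total variation of [v] allows moving it
    to the left; that of [w] may be infinite. *)
Lemma TR_optimal_inner (alpha : R) v (g w : L2) (Delta : R) : 0 < alpha ->
  (TV t0 tf v < +oo)%E -> TR_optimal nu alpha v g Delta v -> TR_feasible nu v Delta w ->
  (alpha%:E * TV t0 tf v <= (inner g (w - v))%:E + alpha%:E * TV t0 tf w)%E.
Proof.
move=> a0 TVv [_ opt] fw; have := opt w fw.
have : TV t0 tf v \is a fin_num by rewrite fin_numElt TV_gtNy.
rewrite /TR_objective subrr innerr0 => /fineK <-.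
rewrite add0e -EFinM subee// => le.
by rewrite -[leLHS]add0e -leeBrDr.
Qed.

End fixed_values.

Theorem theorem4p14 (R : realType) (t0 tf : R) (t0_lt_tf : t0 < tf)
  (alpha : R) (alpha_gt0 : 0 < alpha)
  (M : nat) (M_gt0 : (0 < M)%N)
  (nu : 'I_M -> int) (nu_incr : forall i j : 'I_M, (i < j)%N -> nu i < nu j)
  (F : L2 t0 tf -> R)
  (F_lsc : lower_semicontinuous (fun u : L2 t0 tf => (F u)%:E))
  (F_bounded_below : exists m : R, forall u : L2 t0 tf, m <= F u)
  (v : L2 t0 tf) (v_FP : FP nu v) (v_BV : BV t0 tf v)
  (n : nat) (t : 'rV[R]_n) (a : 'I_n.+1 -> int)
  (v_rep : reduced_representation nu v t a) :
  [/\ L_optimal F a t -> hessian_assumption F -> L_stationary F v t a,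

      differentiable F v ->
      (exists2 Delta : R, 0 < Delta & TR_optimal nu alpha v (grad F v) Delta v) ->
      L_stationary F v t a,

      (exists2 r : R, 0 < r & r_optimal nu F alpha r v) ->
      L_local_minimizer F a t /\
      (hessian_assumption F -> L_stationary F v t a)

    & convex_function [set: convex_lmodType (L2 t0 tf)] F ->
      differentiable F v ->
      forall Delta : R, 0 < Delta ->
        TR_optimal nu alpha v (grad F v) Delta v ->
        r_optimal nu F alpha Delta v].
Proof.
have [vE anu st _] := v_rep.
have ot : ordered t0 tf t by move=> i; exact/ltW.
have [_ TVv] := v_BV.
have TVfin : TV t0 tf v \is a fin_num by rewrite fin_numElt TV_gtNy.
have TVs s : ordered t0 tf s -> (TV t0 tf (stepL2 t0 tf s a) <= TV t0 tf v)%E.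
  by move=> os; rewrite vE; exact: TV_stepL2_le.
have FPs s : ordered t0 tf s -> FP nu (stepL2 t0 tf s a).
  by move=> os; exact: stepL2_FP.
have aTVs s : ordered t0 tf s ->
    (alpha%:E * TV t0 tf (stepL2 t0 tf s a) <= alpha%:E * TV t0 tf v)%E.
  by move=> os; apply: lee_wpmul2l; [rewrite lee_fin ltW|exact: TVs].
have aTVfin : (alpha%:E * TV t0 tf v)%E \is a fin_num by rewrite fin_numM.
have local_min_stat : hessian_assumption F -> L_local_minimizer F a t ->
    L_stationary F v t a.
  by rewrite vE; exact: local_minimizer_L_stationary.
have r_opt_local r : 0 < r -> r_optimal nu F alpha r v -> L_local_minimizer F a t.
  move=> r0 [_ opt]; split=> //; have := near_L1norm_step a ot r0.
  apply: filterS => s near_s os; rewrite -vE.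
  have := opt (stepL2 t0 tf s a) (FPs s os).
  rewrite {1}vE => /(_ (near_s os)) le.
  (* The competitor has no larger total variation, so its term may be replaced by that of [v] and
     then cancelled, leaving an inequality for [F] alone. *)
  rewrite -lee_fin -(leeD2rE _ _ aTVfin) (le_trans le)// leeD2l//.
  exact: aTVs.
split.
- move=> [_ Fmin] hF; apply: local_min_stat => //; split=> //.
  by apply/near_rVP; exists 1 => // s _; exact: Fmin.
- move=> dF [Delta D0 opt]; rewrite vE.
  (* The trust-region objective is linear in [w - v] apart from the total variation, so no quadratic
     remainder arises. *)
  apply: (@L_stationary_criterion _ _ _ _ _ _ _ (fun=> 0)) => // i.
  have := near_shift_node i (near_L1norm_step a ot D0).
  apply: filterS => h near_h os; rewrite mul0r addr0 -vE.
  have feas : TR_feasible nu v Delta (stepL2 t0 tf (shift_node t i h) a).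
    split; first exact: FPs.
    by rewrite L1normBC vE; exact: near_h.
  have le := TR_optimal_inner t0_lt_tf alpha_gt0 TVv opt feas.
  have := le_trans le (leeD2l _ (aTVs _ os)).
  by rewrite -{1}[(alpha%:E * _)%E]add0e (leeD2rE _ _ aTVfin) lee_fin.
- move=> [r r0 opt]; have loc := r_opt_local r r0 opt.
  by split=> // hF; exact: local_min_stat.
- move=> cF dF Delta D0 opt; split=> // w wFP wD.
  have feas : TR_feasible nu v Delta w by split=> //; rewrite L1normBC.
  have le := TR_optimal_inner t0_lt_tf alpha_gt0 TVv opt feas.
  (* After adding [F v], the linear term is the derivative at [v] in direction [w - v], and the
     gradient inequality replaces it by [F w]. Feasibility is the same ball, whence the radius
     [Delta]. *)
  apply: (le_trans (leeD2l (F v)%:E le)).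
  rewrite addeA -EFinD leeD2r// lee_fin -grad_inner//.
  exact: convex_diff_le.
Qed.
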